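(* Let $V$ be a valuation ring with residue field $F$, containing a field $k$, and let $k'$ be a field extension of $k$. Assume that the ring $k'\otimes_k F$ is reduced. Then there exists a weakly unramified extension $W$ of $V$ containing $k'$ (compatibly with $k\subset V$) whose residue field $F_1$ is a composite extension of $k'$ and $F$ over $k$. Moreover, one can require that $F_1$ be separable over $F$ (resp. over $k'$) if $k'$ (resp. $F$) is separable over $k$.
   Context: Rings are commutative with unit. The value group of a valuation ring $V$ with fraction field $K$ is the totally ordered abelian group $K^\times/V^\times$. An extension of a valuation ring $V$ is an injective local homomorphism $j:V\to W$ with $W$ a valuation ring; it is weakly unramified if the induced injective homomorphism of value groups is an isomorphism. A composite extension of two extensions $L,M$ of a field $K$ is a triple $(E,u,v)$ where $E$ is an extension of $K$ and $u:L\to E$, $v:M\to E$ are $K$-embeddings such that $u(L)\cup v(M)$ generates $E$ as a field; here the embeddings of $k'$ and $F$ in $F_1$ are those induced by $k'\subset W$ and $V\to W$. A (not necessarily algebraic) field extension $L/K$ is separable if $L\otimes_K K'$ is reduced for every field extension $K'$ of $K$. *)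

(* Defs.v *)
From HB Require Import structures.
From mathcomp Require Import all_boot all_algebra.
From mathcomp Require Import generic_quotient ring_quotient fraction.
From mathcomp Require Import boolp.

Set Implicit Arguments.
Unset Strict Implicit.
Unset Printing Implicit Defensive.

Import GRing.Theory.
Local Open Scope ring_scope.
Local Open Scope quotient_scope.

Local Notation "x %:F" := (@FracField.tofrac _ x).

(** * Valuation rings *)

HB.mixin Record isValuationRing V of GRing.IntegralDomain V := {
  valring_subproof : forall x : {fraction V},
    (exists a : V, x = a%:F) \/ (exists a : V, x^-1 = a%:F)
}.

#[short(type="valuationRingType")]
HB.structure Definition ValuationRing :=
  {V of isValuationRing V & GRing.IntegralDomain V}.

(* Extensions of valuation rings: injective local homomorphisms. *)
HB.mixin Record isValuationExtension (V W : valuationRingType) (j : V -> W) := {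
  valext_inj : injective j;
  valext_local : forall a : V, j a \is a GRing.unit -> a \is a GRing.unit
}.

#[short(type="valuationExtension")]
HB.structure Definition ValuationExtension (V W : valuationRingType) :=
  {j of @isValuationExtension V W j & @GRing.RMorphism V W j}.

(** * Residue field *)

Section MaximalIdeal.
Variable V : valuationRingType.

Lemma valring_dvd (a b : V) : (exists c, a = c * b) \/ (exists c, b = c * a).
Proof.
have [->|b0] := eqVneq b 0; first by right; exists 0; rewrite mul0r.
have bF0 : (b%:F : {fraction V}) != 0 by rewrite tofrac_eq0.
have [->|a0] := eqVneq a 0; first by left; exists 0; rewrite mul0r.
have aF0 : (a%:F : {fraction V}) != 0 by rewrite tofrac_eq0.
case: (valring_subproof (a%:F / b%:F)) => -[c cE]; [left|right]; exists c.
  by apply/eqP; rewrite -tofrac_eq tofracM -cE divfK.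
by apply/eqP; rewrite -tofrac_eq tofracM -cE invf_div divfK.
Qed.

Definition maximal_ideal : {pred V} := [pred a : V | a \isn't a GRing.unit].

Lemma maximal_ideal_closed : idealr_closed maximal_ideal.
Proof.
have mM (a u : V) : u \in maximal_ideal -> a * u \in maximal_ideal.
  by rewrite !inE unitrM => /negPf->; rewrite andbF.
have mD (u v : V) : u \in maximal_ideal -> v \in maximal_ideal ->
    u + v \in maximal_ideal.
  move=> mu mv; case: (valring_dvd u v) => -[c E].
    by rewrite E -[X in _ + X]mul1r -mulrDl mM.
  by rewrite E -[X in X + _]mul1r -mulrDl mM.
split; first by rewrite inE unitr0.
  by rewrite inE unitr1.
by move=> a u v mu mv; rewrite mD // mM.
Qed.

HB.instance Definition _ := isIdealr.Build V maximal_ideal maximal_ideal_closed.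

Definition residue_field := {ideal_quot maximal_ideal}.
HB.instance Definition _ := GRing.ComNzRing.on residue_field.

Definition residue (a : V) : residue_field := \pi_residue_field a.

Lemma residue_eq (a b : V) : (residue a == residue b) = (a - b \isn't a GRing.unit).
Proof. by rewrite -Quotient.idealrBE. Qed.

Fact residue_is_zmod_morphism : zmod_morphism residue.
Proof. by move=> a b; rewrite /residue !piE. Qed.

Fact residue_is_monoid_morphism : monoid_morphism residue.
Proof. by split=> [|a b]; rewrite /residue !piE. Qed.

HB.instance Definition _ := GRing.isZmodMorphism.Build V residue_field residue
  residue_is_zmod_morphism.
HB.instance Definition _ := GRing.isMonoidMorphism.Build V residue_field residue
  residue_is_monoid_morphism.

Lemma residueP (x : residue_field) : exists a, x = residue a.
Proof. by exists (repr x); rewrite /residue reprK. Qed.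

Lemma residue_eq0 (a : V) : (residue a == 0) = (a \isn't a GRing.unit).
Proof. by rewrite -(rmorph0 residue) residue_eq subr0. Qed.

Definition residue_inv (x : residue_field) : residue_field :=
  if x == 0 then 0 else residue (repr x)^-1.

Fact residue_mulV x : x != 0 -> residue_inv x * x = 1.
Proof.
move=> x0; rewrite /residue_inv (negPf x0) -[X in _ * X]reprK -/(residue _).
rewrite -rmorphM mulVr ?rmorph1 //.
by apply: contraNT x0; rewrite -residue_eq0 /residue reprK.
Qed.

Fact residue_inv0 : residue_inv 0 = 0.
Proof. by rewrite /residue_inv eqxx. Qed.

HB.instance Definition _ := GRing.ComNzRing_isField.Build residue_field
  residue_mulV residue_inv0.

End MaximalIdeal.

Section ResidueMap.
Variables (V W : valuationRingType) (j : valuationExtension V W).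

Definition residue_map (x : residue_field V) : residue_field W :=
  residue (j (repr x)).

Lemma residue_mapE (a : V) : residue_map (residue a) = residue (j a).
Proof.
apply/eqP; rewrite /residue_map residue_eq -rmorphB.
apply: (contraNN (@valext_local _ _ j _)).
by rewrite -residue_eq /residue reprK.
Qed.

Fact residue_map_is_zmod_morphism : zmod_morphism residue_map.
Proof.
move=> x y; have [a ->] := residueP x; have [b ->] := residueP y.
by rewrite -rmorphB !residue_mapE !rmorphB.
Qed.

Fact residue_map_is_monoid_morphism : monoid_morphism residue_map.
Proof.
split=> [|x y]; first by rewrite -(rmorph1 (@residue V)) residue_mapE !rmorph1.
have [a ->] := residueP x; have [b ->] := residueP y.
by rewrite -rmorphM !residue_mapE !rmorphM.
Qed.

HB.instance Definition _ := GRing.isZmodMorphism.Build _ _ residue_map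
  residue_map_is_zmod_morphism.
HB.instance Definition _ := GRing.isMonoidMorphism.Build _ _ residue_map
  residue_map_is_monoid_morphism.

End ResidueMap.

(** * Value group *)

(* The multiplicative group of a field, written additively in order to use the
   library's quotients of abelian groups. *)
Section MultiplicativeGroup.
Variable K : fieldType.

Definition mul_group := {x : K | x != 0}.
HB.instance Definition _ := SubType.on mul_group.
HB.instance Definition _ := Choice.on mul_group.

Definition mul_group_one : mul_group := Sub 1 (oner_neq0 K).
Definition mul_group_inv (x : mul_group) : mul_group :=
  Sub (val x)^-1 (etrans (congr1 negb (invr_eq0 (val x))) (valP x)).
Definition mul_group_mul (x y : mul_group) : mul_group :=
  Sub (val x * val y) (mulf_neq0 (valP x) (valP y)).

Fact mul_group_mulA : associative mul_group_mul.
Proof. by move=> x y z; apply: val_inj; rewrite /= mulrA. Qed.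
Fact mul_group_mulC : commutative mul_group_mul.
Proof. by move=> x y; apply: val_inj; rewrite /= mulrC. Qed.
Fact mul_group_mul1 : left_id mul_group_one mul_group_mul.
Proof. by move=> x; apply: val_inj; rewrite /= mul1r. Qed.
Fact mul_group_mulV : left_inverse mul_group_one mul_group_inv mul_group_mul.
Proof. by move=> x; apply: val_inj; rewrite /= mulVf // (valP x). Qed.

HB.instance Definition _ := GRing.isZmodule.Build mul_group
  mul_group_mulA mul_group_mulC mul_group_mul1 mul_group_mulV.

Lemma mul_groupB (x y : mul_group) : val (x - y) = val x / val y.
Proof. by []. Qed.

End MultiplicativeGroup.

Section ValueGroup.
Variable V : valuationRingType.

(* The image of V^* in K^*, where K is the fraction field of V. *)
Definition unit_subgroup : {pred mul_group {fraction V}} :=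
  fun x => `[< exists2 a : V, a \is a GRing.unit & val x = a%:F >].

Fact unit_subgroup_zmod_closed : zmod_closed unit_subgroup.
Proof.
split=> [|x y /asboolP[a ua xE] /asboolP[b ub yE]]; apply/asboolP.
  by exists 1; rewrite ?unitr1.
exists (a / b); first by rewrite unitrM unitrV ua.
rewrite mul_groupB xE yE; apply: (canLR (mulfK _)).
  by rewrite tofrac_eq0; apply: contraTneq ub => ->; rewrite unitr0.
by rewrite -tofracM divrK.
Qed.

HB.instance Definition _ := GRing.isZmodClosed.Build
  (mul_group {fraction V}) unit_subgroup unit_subgroup_zmod_closed.

Definition value_group := Quotient.quot unit_subgroup.
HB.instance Definition _ := GRing.Zmodule.on value_group.

Definition value (x : mul_group {fraction V}) : value_group := \pi_value_group x.

End ValueGroup.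

Section ValueGroupMap.
Variables (V W : valuationRingType) (j : valuationExtension V W).

Definition frac_map (x : {fraction V}) : {fraction W} :=
  (j \n_(repr x))%:F / (j \d_(repr x))%:F.

Lemma valext_eq0 (a : V) : (j a == 0) = (a == 0).
Proof. by rewrite -(rmorph0 j) (inj_eq (@valext_inj _ _ j)). Qed.

Lemma frac_numden (x : {fraction V}) : (\n_(repr x))%:F / (\d_(repr x))%:F = x.
Proof.
have d0 := denom_ratioP (repr x).
apply: (canLR (mulfK _)); first by rewrite tofrac_eq0.
rewrite -[X in X * _]reprK; unlock FracField.tofrac.
rewrite -[RHS]FracField.pi_mul; apply/eqmodP.
by rewrite /= FracField.equivfE /FracField.mulf !numden_Ratio ?mulr1 ?oner_neq0 // mul1r.
Qed.

Lemma fracP (x : {fraction V}) : exists a b : V, b != 0 /\ x = a%:F / b%:F.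
Proof.
exists \n_(repr x), \d_(repr x).
by split; [exact: denom_ratioP | rewrite frac_numden].
Qed.

Lemma frac_mapE (a b : V) : b != 0 -> frac_map (a%:F / b%:F) = (j a)%:F / (j b)%:F.
Proof.
move=> b0; rewrite /frac_map; move: (frac_numden (a%:F / b%:F)).
have := denom_ratioP (repr (a%:F / b%:F : {fraction V})).
move: (repr _) => y d0 /eqP E; apply/eqP; move: E.
rewrite !eqr_div ?tofrac_eq0 ?valext_eq0 // -!tofracM !tofrac_eq -!rmorphM.
by rewrite (inj_eq (@valext_inj _ _ j)).
Qed.

Lemma frac_map_tofrac (a : V) : frac_map a%:F = (j a)%:F.
Proof.
by rewrite -[a%:F]divr1 -tofrac1 frac_mapE ?oner_eq0 // rmorph1 tofrac1 divr1.
Qed.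

Fact frac_map_is_zmod_morphism : zmod_morphism frac_map.
Proof.
move=> x y; have [a [b [b0 ->]]] := fracP x; have [c [d [d0 ->]]] := fracP y.
have bF0 : (b%:F : {fraction V}) != 0 by rewrite tofrac_eq0.
have dF0 : (d%:F : {fraction V}) != 0 by rewrite tofrac_eq0.
have jb0 : ((j b)%:F : {fraction W}) != 0 by rewrite tofrac_eq0 valext_eq0.
have jd0 : ((j d)%:F : {fraction W}) != 0 by rewrite tofrac_eq0 valext_eq0.
rewrite -mulNr addf_div // -tofracN -!tofracM -tofracD !frac_mapE ?mulf_neq0 //.
by rewrite -mulNr addf_div // !(rmorphM, rmorphD, rmorphN).
Qed.

Fact frac_map_is_monoid_morphism : monoid_morphism frac_map.
Proof.
split=> [|x y]; first by rewrite -tofrac1 frac_map_tofrac rmorph1 tofrac1.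
have [a [b [b0 ->]]] := fracP x; have [c [d [d0 ->]]] := fracP y.
by rewrite mulf_div -!tofracM !frac_mapE ?mulf_neq0 // mulf_div !rmorphM.
Qed.

HB.instance Definition _ := GRing.isZmodMorphism.Build _ _ frac_map
  frac_map_is_zmod_morphism.
HB.instance Definition _ := GRing.isMonoidMorphism.Build _ _ frac_map
  frac_map_is_monoid_morphism.

Definition mul_group_map (x : mul_group {fraction V}) : mul_group {fraction W} :=
  Sub (frac_map (val x)) (etrans (congr1 negb (fmorph_eq0 _ (val x))) (valP x)).

Definition value_group_map (x : value_group V) : value_group W :=
  value (mul_group_map (repr x)).

Lemma value_group_mapE (x : mul_group {fraction V}) :
  value_group_map (value x) = value (mul_group_map x).
Proof.
apply/eqP; rewrite /value_group_map /value -Quotient.idealrBE.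
have : repr (value x) - x \in @unit_subgroup V.
  by rewrite Quotient.idealrBE /value reprK.
case/asboolP=> a ua aE; apply/asboolP; exists (j a); first exact: rmorph_unit.
by rewrite mul_groupB /= -fmorph_div -frac_map_tofrac -aE.
Qed.

Fact value_group_map_is_zmod_morphism : zmod_morphism value_group_map.
Proof.
move=> x y; rewrite -[x]reprK -[y]reprK -/(value _) -/(value (repr y)).
have valueB (U : valuationRingType) (a b : mul_group {fraction U}) :
  value a - value b = value (a - b) by rewrite /value !piE.
rewrite valueB !value_group_mapE valueB; congr value.
by apply: val_inj; exact: (fmorph_div frac_map).
Qed.

HB.instance Definition _ := GRing.isZmodMorphism.Build _ _ value_group_map
  value_group_map_is_zmod_morphism.

(* The orders of the value groups play no role here: value_group_map is a
   monotone group morphism between totally ordered groups, so it is an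
   isomorphism as soon as it is bijective. *)
Definition weakly_unramified := bijective value_group_map.

End ValueGroupMap.

(** * Tensor products of commutative rings *)

(* The tensor product over R of two R-algebras given by their structure maps. Its
   elements are formal sums of pure tensors, represented by sequences of pairs,
   two of which are identified when they have the same image under every
   R-balanced biadditive map. *)
Section Tensor.
Variables (R A B : comNzRingType).
Variables (f : {rmorphism R -> A}) (g : {rmorphism R -> B}).

Record balanced (M : zmodType) (phi : A -> B -> M) : Prop := Balanced {
  balancedDl : forall a a' b, phi (a + a') b = phi a b + phi a' b;
  balancedDr : forall a b b', phi a (b + b') = phi a b + phi a b';
  balancedM : forall r a b, phi (a * f r) b = phi a (g r * b)
}.

Lemma balancedNl (M : zmodType) (phi : A -> B -> M) :
  balanced phi -> forall a b, phi (- a) b = - phi a b.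
Proof.
move=> bp a b; have p0 : phi 0 b = 0.
  by apply: (addrI (phi 0 b)); rewrite -(balancedDl bp) !addr0.
by apply: (addrI (phi a b)); rewrite -(balancedDl bp) !subrr.
Qed.

Definition tensor_eval (M : zmodType) (phi : A -> B -> M) (s : seq (A * B)) : M :=
  \sum_(p <- s) phi p.1 p.2.

Definition tensor_equiv (s t : seq (A * B)) : bool :=
  `[< forall (M : zmodType) (phi : A -> B -> M),
        balanced phi -> tensor_eval phi s = tensor_eval phi t >].

Fact tensor_equiv_is_equiv : equiv_class_of tensor_equiv.
Proof.
split=> [s|s t|t s u]; first exact/asboolP.
  by apply/asboolP/asboolP => E M phi bp; rewrite E.
by move=> /asboolP E /asboolP E'; apply/asboolP => M phi bp; rewrite E // E'.
Qed.

Canonical tensor_equiv_equiv := EquivRelPack tensor_equiv_is_equiv.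
Canonical tensor_equiv_encModRel := defaultEncModRel tensor_equiv.

Definition tensor := {eq_quot tensor_equiv}.
HB.instance Definition _ : EqQuotient _ tensor_equiv tensor := EqQuotient.on tensor.
HB.instance Definition _ := Choice.on tensor.

Lemma tensor_eqP (s t : seq (A * B)) :
  (forall (M : zmodType) (phi : A -> B -> M),
     balanced phi -> tensor_eval phi s = tensor_eval phi t) <->
  \pi_tensor s = \pi_tensor t.
Proof. by split=> [E|/eqmodP/asboolP//]; apply/eqmodP/asboolP. Qed.

Lemma tensor_eval_repr (M : zmodType) (phi : A -> B -> M) s :
  balanced phi -> tensor_eval phi (repr (\pi_tensor s)) = tensor_eval phi s.
Proof. by move=> bp; apply/(tensor_eqP _ _).2; rewrite ?reprK. Qed.

Definition tensor_add (x y : tensor) : tensor := \pi_tensor (repr x ++ repr y).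
Definition tensor_opp (x : tensor) : tensor :=
  \pi_tensor [seq (- p.1, p.2) | p <- repr x].
Definition tensor_mul (x y : tensor) : tensor :=
  \pi_tensor [seq (p.1 * q.1, p.2 * q.2) | p <- repr x, q <- repr y].

Definition tensor_lift (M : zmodType) (phi : A -> B -> M) (x : tensor) : M :=
  tensor_eval phi (repr x).

Lemma tensor_ext (x y : tensor) :
  (forall (M : zmodType) (phi : A -> B -> M),
     balanced phi -> tensor_lift phi x = tensor_lift phi y) -> x = y.
Proof. by move=> E; rewrite -[x]reprK -[y]reprK; apply/tensor_eqP. Qed.

Section Lift.
Variables (M : zmodType) (phi : A -> B -> M).
Hypothesis bp : balanced phi.

Lemma tensor_lift_pi s : tensor_lift phi (\pi_tensor s) = tensor_eval phi s.
Proof. exact: tensor_eval_repr. Qed.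

Lemma tensor_lift_add x y :
  tensor_lift phi (tensor_add x y) = tensor_lift phi x + tensor_lift phi y.
Proof. by rewrite tensor_lift_pi /tensor_eval big_cat. Qed.

Lemma tensor_lift_opp x : tensor_lift phi (tensor_opp x) = - tensor_lift phi x.
Proof.
rewrite tensor_lift_pi /tensor_lift /tensor_eval big_map -sumrN.
by apply: eq_bigr => p _; rewrite balancedNl.
Qed.

Lemma balanced_mulr c d : balanced (fun a b => phi (a * c) (b * d)).
Proof.
split=> [a a' b|a b b'|r a b].
- by rewrite mulrDl (balancedDl bp).
- by rewrite mulrDl (balancedDr bp).
- by rewrite mulrAC (balancedM bp) mulrA.
Qed.

Lemma balanced_lift_mul y :
  balanced (fun a b => tensor_lift (fun c d => phi (a * c) (b * d)) y).
Proof.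
split=> [a a' b|a b b'|r a b]; rewrite /tensor_lift /tensor_eval -?big_split /=;
  apply: eq_bigr => q _; have bq := balanced_mulr q.1 q.2.
- exact: (balancedDl bq).
- exact: (balancedDr bq).
- exact: (balancedM bq).
Qed.

Lemma tensor_lift_mul x y : tensor_lift phi (tensor_mul x y) =
  tensor_lift (fun a b => tensor_lift (fun c d => phi (a * c) (b * d)) y) x.
Proof. by rewrite tensor_lift_pi /tensor_lift /tensor_eval big_allpairs_dep. Qed.

End Lift.

Definition tens (a : A) (b : B) : tensor := \pi_tensor [:: (a, b)].

Lemma tensor_lift_tens (M : zmodType) (phi : A -> B -> M) a b :
  balanced phi -> tensor_lift phi (tens a b) = phi a b.
Proof. by move=> bp; rewrite tensor_lift_pi // /tensor_eval big_seq1. Qed.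

Fact tensor_addA : associative tensor_add.
Proof. by move=> x y z; apply: tensor_ext => M phi bp; rewrite !tensor_lift_add // addrA. Qed.

Fact tensor_addC : commutative tensor_add.
Proof. by move=> x y; apply: tensor_ext => M phi bp; rewrite !tensor_lift_add // addrC. Qed.

Lemma tensor_lift0 (M : zmodType) (phi : A -> B -> M) :
  balanced phi -> tensor_lift phi (\pi_tensor [::]) = 0.
Proof. by move=> bp; rewrite tensor_lift_pi // /tensor_eval big_nil. Qed.

Fact tensor_add0 : left_id (\pi_tensor [::]) tensor_add.
Proof.
move=> x; apply: tensor_ext => M phi bp.
by rewrite tensor_lift_add // tensor_lift0 // add0r.
Qed.

Fact tensor_addN : left_inverse (\pi_tensor [::]) tensor_opp tensor_add.
Proof.
move=> x; apply: tensor_ext => M phi bp.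
by rewrite tensor_lift_add // tensor_lift_opp // tensor_lift0 // addNr.
Qed.

HB.instance Definition _ := GRing.isZmodule.Build tensor
  tensor_addA tensor_addC tensor_add0 tensor_addN.

Fact tensor_mulA : associative tensor_mul.
Proof.
move=> x y z; apply: tensor_ext => M phi bp.
rewrite tensor_lift_mul // tensor_lift_mul // tensor_lift_mul; last first.
  exact: balanced_lift_mul.
apply: eq_bigr => p _; rewrite tensor_lift_mul; last by
  split=> [a a' b|a b b'|r a b];
    rewrite ?mulrDr ?(balancedDl bp) ?(balancedDr bp) // mulrA (balancedM bp) mulrCA.
by apply: eq_bigr => q _; apply: eq_bigr => r _; rewrite !mulrA.
Qed.

Fact tensor_mulC : commutative tensor_mul.
Proof.
move=> x y; apply: tensor_ext => M phi bp.
rewrite !tensor_lift_mul // /tensor_lift /tensor_eval exchange_big.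
by apply: eq_bigr => q _; apply: eq_bigr => p _; rewrite !(mulrC q.1) (mulrC q.2).
Qed.

Fact tensor_mul1 : left_id (tens 1 1) tensor_mul.
Proof.
move=> x; apply: tensor_ext => M phi bp; rewrite tensor_lift_mul // tensor_lift_tens.
  by apply: eq_bigr => p _; rewrite !mul1r.
exact: balanced_lift_mul.
Qed.

Fact tensor_mulDl : left_distributive tensor_mul tensor_add.
Proof.
move=> x y z; apply: tensor_ext => M phi bp.
rewrite tensor_lift_add // !tensor_lift_mul // tensor_lift_add //.
exact: balanced_lift_mul.
Qed.

(* The tensor product may be the zero ring, whence PzRing. *)
HB.instance Definition _ := GRing.Zmodule_isComPzRing.Build tensor
  tensor_mulA tensor_mulC tensor_mul1 tensor_mulDl.

Lemma tens_balanced : balanced tens.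
Proof.
split=> [a a' b|a b b'|r a b]; apply: tensor_ext => M phi bp;
  rewrite ?[tensor_lift phi (_ + _)]tensor_lift_add // !tensor_lift_tens //.
- exact: (balancedDl bp).
- exact: (balancedDr bp).
- exact: (balancedM bp).
Qed.

Lemma tensM a a' b b' : tens a b * tens a' b' = tens (a * a') (b * b').
Proof.
apply: tensor_ext => M phi bp; rewrite [LHS]tensor_lift_mul //.
rewrite !tensor_lift_tens //; last exact: balanced_lift_mul.
by split=> [c c' d|c d d'|r c d];
  rewrite ?mulrDr ?(balancedDl bp) ?(balancedDr bp) // mulrA (balancedM bp) mulrCA.
Qed.

Lemma tensor_sum_tens (x : tensor) : x = \sum_(p <- repr x) tens p.1 p.2.
Proof.
rewrite -[LHS]reprK; elim: (repr x) => [|[a b] s IHs]; first by rewrite big_nil.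
rewrite big_cons -IHs; apply: tensor_ext => M phi bp.
rewrite [RHS]tensor_lift_add // tensor_lift_tens // !tensor_lift_pi //.
by rewrite /tensor_eval big_cons.
Qed.

End Tensor.

(** * Reducedness, separability and composite extensions *)

Definition reduced (R : comPzRingType) :=
  forall (x : R) (n : nat), x ^+ n = 0 -> x = 0.

Definition separable (K L : fieldType) (f : {rmorphism K -> L}) :=
  forall (K' : fieldType) (g : {rmorphism K -> K'}), reduced (tensor f g).

(* (E, u, v) is a composite extension of L and M, seen as extensions of K via
   a and b; E is seen as an extension of K via the common value of u \o a and
   v \o b. *)
Definition composite_extension (K L M E : fieldType)
    (a : {rmorphism K -> L}) (b : {rmorphism K -> M})
    (u : {rmorphism L -> E}) (v : {rmorphism M -> E}) :=
  u \o a =1 v \o b /\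
  forall S : {pred E}, GRing.divring_closed S ->
    (forall x, u x \in S) -> (forall y, v y \in S) -> forall z, z \in S.

(* Main.v *)
Require Import Defs.
From HB Require Import structures.
From mathcomp Require Import all_boot all_algebra.
From mathcomp Require Import perm generic_quotient ring_quotient fraction.
From mathcomp Require Import boolp ring.
From mathcomp Require classical_sets.

Set Implicit Arguments.
Unset Strict Implicit.
Unset Printing Implicit Defensive.

Import GRing.Theory.
Local Open Scope ring_scope.

(** Write A for the tensor product of k' and V over k, and B for that of k' and the residue
    field F; B is the quotient of A by the ideal generated by the maximal ideal m of V. Choose a
    minimal prime of B, and let pi : A -> kappa be the induced map to its residue field, with
    kernel P. Since B is reduced, its localization at the chosen prime is a field, so the local
    ring of A at P has maximal ideal generated by m. This local ring is the extension W.

    What has to be shown is that every x in A has a content: s x = a z with a in V and s, z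
    outside P. Contents make W a valuation ring with the value group of V, and its residue field
    is a localization of B. Hence the residue field is generated by k' and F, and it inherits
    separability from the tensor products, because localization preserves reducedness
    (separable_compositum).

    Contents are constructed by adjoining to k one element of k' at a time (content_adjoin), an
    element of A having coefficients in a finitely generated subfield. Suppose that D is a
    subfield for which contents exist, with valuation ring R, and let t be the next element. One
    has to study the elements h(t) for h in R[X]. Minimality of the prime descends to D(t)
    (annihilator_descent) and says that, after reduction modulo m, a polynomial h that vanishes at
    t in kappa becomes a multiple of the minimal polynomial f of t when multiplied by some
    polynomial s that does not vanish at t. If t is
    transcendental over D, then f = 0, so the residue of t is transcendental, and the Gauss
    content of h does the job. If t is algebraic, R[X]/(f) is a finite free R-module which may
    have several maximal ideals. The content of h at the chosen one is then an elementary divisor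
    of the multiplication by h, as a Smith normal form and a determinant trick show
    (algebraic_step).

    All these identities, and the local ring of A at P, are read in a field E, the residue field of
    a prime of A that contains no product of a nonzero scalar of V and an element outside P. Such
    a prime exists because A is torsion-free over V. *)

(** * Linear forms over a subfield *)

(** Zorn's lemma for a family of subsets that is stable under unions of nonempty chains; the empty
    union is avoided by starting from a member of the family. *)
Lemma maximal_set (T : Type) (P : (T -> Prop) -> Prop) (X0 : T -> Prop) :
  P X0 ->
  (forall F : (T -> Prop) -> Prop, (exists X, F X) ->
     (forall X, F X -> P X) ->
     (forall X Y, F X -> F Y ->
        (forall x, X x -> Y x) \/ (forall x, Y x -> X x)) ->
     P (fun x => exists2 X, F X & X x)) ->
  exists M, [/\ P M, forall x, X0 x -> M x &
    forall Y, P Y -> (forall x, M x -> Y x) -> forall x, Y x -> M x].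
Proof.
move=> PX0 Pchain.
pose Q (X : T -> Prop) := (forall x, ~ X x) \/ (P X /\ forall x, X0 x -> X x).
have [F FQ Ftot|M [QM Mmax]] := @classical_sets.Zorn_bigcup T Q.
  have [[X [FX [x Xx]]]|noX] := pselect (exists X, F X /\ exists x, X x); last first.
    by left=> x [X FX Xx]; apply: noX; exists X; split=> //; exists x.
  pose G (X : T -> Prop) := F X /\ exists x, X x.
  have GP Y : G Y -> P Y /\ forall x, X0 x -> Y x.
    by move=> [FY [y Yy]]; case: (FQ _ FY) => // /(_ y).
  right; split.
    suff -> : classical_sets.bigcup F id = (fun x => exists2 X, G X & X x).
      apply: Pchain; first by exists X; split=> //; exists x.
        by move=> Y /GP[].
      by move=> Y Z [FY _] [FZ _]; exact: Ftot.
    apply: funext => z; apply: propext; split=> [[Y FY Yz]|[Y [FY _] Yz]]; last by exists Y.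
    by exists Y => //; split=> //; exists z.
  by have [|_ h] := GP X; [split=> //; exists x | move=> z /h Xz; exists X].
have maxM Y : Q Y -> (forall x, M x -> Y x) -> forall x, Y x -> M x.
  move=> QY MY x Yx; apply: contrapT => nMx; apply: (Mmax Y) => //.
  by split=> // YM; apply: nMx; exact: YM.
case: QM => [M0|[PM X0M]].
  have X0M : forall x, X0 x -> M x.
    by apply: maxM => [|x /M0 //]; right.
  have X00 x : ~ X0 x by move/X0M/M0.
  exists X0; split=> // Y PY X0Y x Yx; case: (M0 x).
  by apply: (maxM Y) => // [|z /M0//]; right; split.
exists M; split=> // Y PY MY; apply: maxM => //.
by right; split=> // x /X0M/MY.
Qed.

Section Functionals.
Variables (L : fieldType) (D : {pred L}).
Hypothesis DD : GRing.divring_closed D.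

Definition linear_form (l : L -> L) :=
  [/\ {morph l : x y / x + y}, forall c x, c \in D -> l (c * x) = c * l x
    & forall x, l x \in D].

Definition subspace (U : L -> Prop) :=
  U 0 /\ forall c x y, c \in D -> U x -> U y -> U (c * x + y).

Let D1 : 1 \in D. Proof. by case: DD. Qed.
Let DB x y : x \in D -> y \in D -> x - y \in D. Proof. by case: DD => _ + _; exact. Qed.
Let Ddiv x y : x \in D -> y \in D -> x / y \in D. Proof. by case: DD => _ _; exact. Qed.
Let D0 : 0 \in D. Proof. by rewrite -(subrr 1) DB. Qed.
Let DN x : x \in D -> - x \in D. Proof. by move=> Dx; rewrite -sub0r DB. Qed.
Let DAdd x y : x \in D -> y \in D -> x + y \in D.
Proof. by move=> Dx Dy; rewrite -[y]opprK DB ?DN. Qed.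
Let DM x y : x \in D -> y \in D -> x * y \in D.
Proof. by move=> Dx Dy; rewrite -[y]invrK Ddiv // -div1r Ddiv. Qed.

(** A subspace M that contains U and is maximal among those avoiding x is a complement of the line
    D x: if y is not in M, then x lies in M + D y, so y lies in M + D x. The form is the coordinate
    along x. *)
Lemma linear_form_exists (U : L -> Prop) (x : L) : subspace U -> ~ U x ->
  exists l, [/\ linear_form l, forall y, U y -> l y = 0 & l x = 1].
Proof.
move=> sU nUx.
have [|F [X0 FX0] FP Ftot|M [[sM nMx] UM maxM]] :=
    @maximal_set _ (fun X => subspace X /\ ~ X x) U; first by split.
  split; last by case=> X /FP[_ nX] /nX.
  split; first by exists X0 => //; have [[]] := FP _ FX0.
  move=> c y z Dc [X FX Xy] [Y FY Yz].
  have [XY|YX] := Ftot _ _ FX FY; [exists Y|exists X] => //.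
    by case: (FP _ FY) => -[_ sY] _; apply: sY => //; apply: XY.
  by case: (FP _ FX) => -[_ sX] _; apply: sX => //; apply: YX.
have [M0 Mc] := sM.
have MB y z : M y -> M z -> M (y - z).
  by move=> My Mz; rewrite -mulN1r addrC; apply: Mc => //; apply: DN.
have MZ c y : c \in D -> M y -> M (c * y).
  by move=> Dc My; rewrite -[_ * _]addr0; apply: Mc.
have ex y : exists c, (c \in D) /\ M (y - c * x).
  have [My|nMy] := pselect (M y); first by exists 0; rewrite mul0r subr0.
  pose N z := exists2 c, c \in D & M (z - c * y).
  have sN : subspace N.
    split; first by exists 0; rewrite ?mul0r ?subr0.
    move=> c z1 z2 Dc [c1 Dc1 M1] [c2 Dc2 M2]; exists (c * c1 + c2).
      by rewrite DAdd ?DM.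
    have -> : c * z1 + z2 - (c * c1 + c2) * y = c * (z1 - c1 * y) + (z2 - c2 * y).
      by rewrite mulrBr mulrDl opprD mulrA addrACA.
    exact: Mc.
  have MN z : M z -> N z by exists 0; rewrite ?mul0r ?subr0.
  have [[c Dc Mxc]|nNx] := pselect (N x).
    have c0 : c != 0 by apply: contra_notN nMx => /eqP c0; move: Mxc; rewrite c0 mul0r subr0.
    exists c^-1; split; first by rewrite -div1r Ddiv.
    have -> : y - c^-1 * x = (- c^-1) * (x - c * y).
      by rewrite mulrBr !mulNr opprK mulrA mulVf // mul1r addrC.
    by apply: MZ => //; rewrite DN // -div1r Ddiv.
  case: nMy; apply: (maxM N) => //.
  by exists 1; rewrite ?mul1r ?subrr.
have uniq y c d : c \in D -> d \in D -> M (y - c * x) -> M (y - d * x) -> c = d.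
  move=> Dc Dd Mc1 Md1; apply/eqP; rewrite -subr_eq0; apply: contra_notT nMx => cd0.
  have -> : x = (c - d)^-1 * ((y - d * x) - (y - c * x)).
    have -> : y - d * x - (y - c * x) = (c - d) * x by ring.
    by rewrite mulKf.
  by apply: MZ; [rewrite -div1r Ddiv ?DB | apply: MB].
have [l lP] := choice ex; exists l; split=> [|y /UM My|].
- split=> [y z|c y Dc|y]; last by case: (lP y).
    have [[[Dy My] [Dz Mz]] [Dyz Myz]] := (lP y, lP z, lP (y + z)).
    apply: (@uniq (y + z)) => //; first exact: DAdd.
    rewrite mulrDl opprD addrACA -[X in M (X + _)]mul1r; exact: Mc.
  have [[Dy My] [Dcy Mcy]] := (lP y, lP (c * y)).
  apply: (@uniq (c * y)) => //; first exact: DM.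
  by rewrite -mulrA -mulrBr; apply: MZ.
- have [Dy My'] := lP y.
  by apply: (@uniq y) => //; rewrite mul0r subr0.
- have [Dy My'] := lP x.
  by apply: (@uniq x) => //; rewrite mul1r subrr.
Qed.

(** This replaces a basis of L over D: only finitely many elements have to be decomposed at a time.
    A new vector fixed by the projection defined by F needs no new coordinate; otherwise one
    adds a form that vanishes on the vectors fixed by this projection. *)
Lemma finite_coordinates (s : seq L) :
  exists F : seq (L * {l : L -> L | linear_form l}),
    forall x, x \in s -> x = \sum_(p <- F) sval p.2 x * p.1.
Proof.
elim: s => [|x s [F Fs]]; first by exists [::].
pose U y := y = \sum_(p <- F) sval p.2 y * p.1.
have [Ux|nUx] := pselect (U x).
  by exists F => y; rewrite inE => /predU1P[->//|]; exact: Fs.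
have sU : subspace U.
  split=> [|c y z Dc]; rewrite /U.
    rewrite big1 // => -[g [l [_ lZ _]]] _ /=.
    by rewrite -(mul0r 0) lZ // !mul0r.
  move=> Uy Uz; rewrite [in LHS]Uy [in LHS]Uz mulr_sumr -big_split /=.
  apply: eq_bigr => -[g [l [lD lZ _]]] _ /=.
  by rewrite lD lZ // mulrDl mulrA.
have [l [ll lU lx]] := linear_form_exists sU nUx.
exists ((x - \sum_(p <- F) sval p.2 x * p.1, exist _ l ll) :: F) => y.
rewrite inE big_cons /= => /predU1P[->|/Fs yE]; first by rewrite lx mul1r subrK.
by rewrite lU // mul0r add0r.
Qed.

End Functionals.

(** * Tensor products by their universal property *)

(** The universal property, rather than the concrete tensor product, so that the two factors can be
    exchanged and a tensor product can be viewed as a ring with 1 <> 0, over which there are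
    polynomials. *)
Definition is_tensor (K A B : comNzRingType) (a : {rmorphism K -> A})
    (b : {rmorphism K -> B}) (T : comPzRingType)
    (p : {rmorphism A -> T}) (q : {rmorphism B -> T}) : Prop :=
  [/\ forall c, p (a c) = q (b c),
      forall z, exists s : seq (A * B), z = \sum_(i <- s) p i.1 * q i.2
    & forall (M : zmodType) (phi : A -> B -> M), balanced a b phi ->
        exists h : {additive T -> M}, forall x y, h (p x * q y) = phi x y].

Section TensorIsTensor.
Variables (K A B : comNzRingType) (a : {rmorphism K -> A}) (b : {rmorphism K -> B}).

Definition tensl (x : A) : tensor a b := tens a b x 1.
Definition tensr (y : B) : tensor a b := tens a b 1 y.

Fact tensl_zmod : zmod_morphism tensl.
Proof.
move=> x y; apply: (addIr (tensl y)); rewrite subrK.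
by rewrite -(balancedDl (tens_balanced a b)) subrK.
Qed.
Fact tensl_monoid : monoid_morphism tensl.
Proof. by split=> // x y; rewrite /tensl tensM mulr1. Qed.
HB.instance Definition _ := GRing.isZmodMorphism.Build A (tensor a b) tensl tensl_zmod.
HB.instance Definition _ := GRing.isMonoidMorphism.Build A (tensor a b) tensl tensl_monoid.

Fact tensr_zmod : zmod_morphism tensr.
Proof.
move=> x y; apply: (addIr (tensr y)); rewrite subrK.
by rewrite -(balancedDr (tens_balanced a b)) subrK.
Qed.
Fact tensr_monoid : monoid_morphism tensr.
Proof. by split=> // x y; rewrite /tensr tensM mulr1. Qed.
HB.instance Definition _ := GRing.isZmodMorphism.Build B (tensor a b) tensr tensr_zmod.
HB.instance Definition _ := GRing.isMonoidMorphism.Build B (tensor a b) tensr tensr_monoid.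

Lemma tenslr x y : tensl x * tensr y = tens a b x y.
Proof. by rewrite tensM mulr1 mul1r. Qed.

Lemma tensor_is_tensor : is_tensor a b tensl tensr.
Proof.
split=> [c|z|M phi bp].
- by have := balancedM (tens_balanced a b) c 1 1; rewrite mulr1 mul1r.
- exists (repr z); rewrite {1}[z]tensor_sum_tens; apply: eq_bigr => i _.
  by rewrite tenslr.
- pose h := tensor_lift phi : tensor a b -> M.
  have hz : zmod_morphism h.
    by move=> x y; rewrite /h [tensor_lift phi (x - y)]tensor_lift_add // tensor_lift_opp.
  pose H : {additive tensor a b -> M} := HB.pack h (GRing.isZmodMorphism.Build _ _ h hz).
  by exists H => x y; rewrite tenslr /= /h tensor_lift_tens.
Qed.

End TensorIsTensor.

Section IsTensor.
Variables (K A B : comNzRingType) (a : {rmorphism K -> A}) (b : {rmorphism K -> B}).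
Variables (T : comPzRingType) (p : {rmorphism A -> T}) (q : {rmorphism B -> T}).
Hypothesis hT : is_tensor a b p q.

Lemma is_tensorC : is_tensor b a q p.
Proof.
case: hT => h1 h2 h3; split=> [c|z|M phi bp]; first by rewrite h1.
  have [s ->] := h2 z; exists [seq (i.2, i.1) | i <- s].
  by rewrite big_map; apply: eq_bigr => i _; rewrite mulrC.
have [|h hE] := h3 M (fun x y => phi y x); last by exists h => x y; rewrite mulrC hE.
split=> [x x' y|x y y'|c x y]; rewrite ?(balancedDl bp) ?(balancedDr bp) //.
by rewrite mulrC -(balancedM bp) mulrC.
Qed.

Lemma is_tensor_rmorph (C : comPzRingType) (u : {rmorphism A -> C}) (v : {rmorphism B -> C}) :
  (forall c, u (a c) = v (b c)) ->
  exists h : {rmorphism T -> C}, (forall x, h (p x) = u x) /\ (forall y, h (q y) = v y).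
Proof.
move=> uv; have [h1 h2 /(_ C (fun x y => u x * v y))[|h hE]] := hT.
  split=> [x x' y|x y y'|c x y]; rewrite ?rmorphD ?mulrDl ?mulrDr //.
  by rewrite !rmorphM -mulrA uv.
have hm : monoid_morphism h.
  split; first by have := hE 1 1; rewrite !rmorph1 !mulr1.
  move=> z w; have [[s ->] [t ->]] := (h2 z, h2 w).
  rewrite mulr_suml !raddf_sum mulr_suml; apply: eq_bigr => i _.
  rewrite mulr_sumr !raddf_sum mulr_sumr; apply: eq_bigr => j _.
  by rewrite mulrACA -!rmorphM !hE !rmorphM mulrACA.
pose H : {rmorphism T -> C} := HB.pack (h : T -> C)
  (GRing.isZmodMorphism.Build _ _ (h : T -> C) (raddfB h))
  (GRing.isMonoidMorphism.Build _ _ (h : T -> C) hm).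
exists H; split=> x; rewrite /=.
  by have := hE x 1; rewrite !rmorph1 !mulr1.
by have := hE 1 x; rewrite !rmorph1 !mul1r.
Qed.

(** The image of the tensor product of D and B in that of A and B. *)
Definition left_span (D : {pred A}) : {pred T} := fun z =>
  `[< exists2 s : seq (A * B), all (fun i => i.1 \in D) s & z = \sum_(i <- s) p i.1 * q i.2 >].

Lemma left_spanP (D : {pred A}) (P : T -> Prop) :
  P 0 -> (forall z w, P z -> P w -> P (z + w)) ->
  (forall x y, x \in D -> P (p x * q y)) ->
  forall z, z \in left_span D -> P z.
Proof.
move=> P0 PD Pp z /asboolP[s + ->].
elim: s => [|i s IH] /=; first by rewrite big_nil.
by rewrite big_cons => /andP[/Pp Pi /IH]; apply: PD.
Qed.

Lemma left_span_tens (D : {pred A}) x y : x \in D -> p x * q y \in left_span D.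
Proof. by move=> Dx; apply/asboolP; exists [:: (x, y)]; rewrite /= ?Dx // big_seq1. Qed.

Lemma left_spanS (D D' : {pred A}) : {subset D <= D'} -> {subset left_span D <= left_span D'}.
Proof. by move=> DD' z /asboolP[s /(sub_all (fun i => DD' i.1)) ? ->]; apply/asboolP; exists s. Qed.

Lemma left_spanD (D : {pred A}) z w :
  z \in left_span D -> w \in left_span D -> z + w \in left_span D.
Proof.
move=> /asboolP[s Ds ->] /asboolP[t Dt ->]; apply/asboolP.
by exists (s ++ t); rewrite ?all_cat ?Ds // big_cat.
Qed.

Lemma left_span0 (D : {pred A}) : 0 \in left_span D.
Proof. by apply/asboolP; exists [::]; rewrite // big_nil. Qed.

Lemma left_spanN (D : {pred A}) z : z \in left_span D -> - z \in left_span D.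
Proof.
move: z; apply: left_spanP => [|u v Du Dv|x y Dx]; first by rewrite oppr0 left_span0.
  by rewrite opprD left_spanD.
by rewrite -mulrN -rmorphN left_span_tens.
Qed.

Lemma left_span_subring (D : {pred A}) : GRing.subring_closed D ->
  GRing.subring_closed (left_span D).
Proof.
case=> D1 DB DM; split.
- by rewrite -[1]mulr1 -[X in X * _](rmorph1 p) -[X in _ * X](rmorph1 q) left_span_tens.
- by move=> z w Dz Dw; rewrite left_spanD ?left_spanN.
- move=> z w Dz Dw; move: z Dz; apply: left_spanP.
  + by rewrite mul0r left_span0.
  + by move=> u v Du Dv; rewrite mulrDl left_spanD.
  + move=> x y Dx; move: w Dw; apply: left_spanP.
    * by rewrite mulr0 left_span0.
    * by move=> u v Du Dv; rewrite mulrDr left_spanD.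
    * by move=> x' y' Dx'; rewrite mulrACA -!rmorphM left_span_tens // DM.
Qed.

End IsTensor.

Section RightCoordinates.
Variables (K : fieldType) (A : comNzRingType) (M : fieldType).
Variables (a : {rmorphism K -> A}) (b : {rmorphism K -> M}).
Variables (T : comPzRingType) (p : {rmorphism A -> T}) (q : {rmorphism M -> T}).
Hypothesis hT : is_tensor a b p q.

(** The extension to T, by linearity over A, of the linear form f on M. *)
Definition right_form (h : {additive T -> A}) :=
  exists f : M -> K, forall x y, h (p x * q y) = x * a (f y).

Lemma right_formM h x z : right_form h -> h (p x * z) = x * h z.
Proof.
move=> [f hE]; have [_ /(_ z)[s ->] _] := hT.
rewrite mulr_sumr !raddf_sum mulr_sumr; apply: eq_bigr => i _.
by rewrite mulrA -rmorphM !hE mulrA.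
Qed.

Lemma right_form_span (h : {additive T -> A}) (D : {pred A}) z : right_form h ->
  GRing.subring_closed D -> (forall c, a c \in D) ->
  z \in left_span p q D -> h z \in D.
Proof.
move=> [f hE] [D1 DB DM] aD; move: z; apply: left_spanP.
- by rewrite raddf0 -(subrr 1) DB.
- move=> u v Du Dv; rewrite raddfD -[h v]opprK DB // -sub0r DB //.
  by rewrite -(subrr 1) DB.
- by move=> x y Dx; rewrite hE DM.
Qed.

Lemma image_divring (K' M' : fieldType) (g : {rmorphism K' -> M'}) :
  GRing.divring_closed (fun x => `[< exists c, x = g c >] : bool).
Proof.
split; first by apply/asboolP; exists 1; rewrite rmorph1.
  by move=> x y /asboolP[c ->] /asboolP[d ->]; apply/asboolP; exists (c - d); rewrite rmorphB.
by move=> x y /asboolP[c ->] /asboolP[d ->]; apply/asboolP; exists (c / d); rewrite fmorph_div.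
Qed.

Lemma right_coordinates z : exists F : seq (M * {h : {additive T -> A} | right_form h}),
  z = \sum_(f <- F) p (sval f.2 z) * q f.1.
Proof.
have [ab /(_ z)[s zE] univ] := hT.
have [F FE] := finite_coordinates (image_divring b) [seq i.2 | i <- s].
have /choice[h hE] (f : M * {l : M -> M | linear_form (fun x => `[< exists c, x = b c >]) l}) :
    exists f' : M * {h : {additive T -> A} | right_form h}, f'.1 = f.1 /\
      forall x y, p (sval f'.2 (p x * q y)) = p x * q (sval f.2 y).
  case: f => g [l [lD lZ lb]]; have /choice[phi phiE] y : exists c, l y = b c by apply/asboolP/lb.
  have [|h hE] := univ A (fun x y => x * a (phi y)).
    split=> [x x' y|x y y'|c x y]; rewrite ?mulrDl //.
      rewrite -mulrDr -rmorphD; congr (_ * a _); apply: (fmorph_inj b).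
      by rewrite rmorphD -!phiE lD.
    rewrite -mulrA -rmorphM; congr (_ * a _); apply: (fmorph_inj b).
    by rewrite rmorphM -!phiE lZ //; apply/asboolP; exists c.
  have rh : right_form h by exists phi.
  by exists (g, exist _ h rh); split=> // x y; rewrite /= hE rmorphM ab phiE.
exists (map h F); rewrite big_map.
transitivity (\sum_(f <- F) \sum_(i <- s) p i.1 * q (sval f.2 i.2 * f.1)); last first.
  apply: eq_bigr => f _; have [-> hfE] := hE f.
  rewrite [in RHS]zE raddf_sum rmorph_sum mulr_suml; apply: eq_bigr => i _.
  by rewrite hfE rmorphM mulrA.
rewrite exchange_big {1}zE big_seq [RHS]big_seq; apply: eq_bigr => i si.
by rewrite -mulr_sumr -rmorph_sum -FE // map_f.
Qed.

End RightCoordinates.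

Section Descent.
Variables (K L : fieldType) (B : comNzRingType).
Variables (a : {rmorphism K -> L}) (b : {rmorphism K -> B}).
Variables (T : comPzRingType) (p : {rmorphism L -> T}) (q : {rmorphism B -> T}).
Hypothesis hT : is_tensor a b p q.
Variables (D : {pred L}) (kappa : comNzRingType) (pi : {rmorphism T -> kappa}).
Hypotheses (DD : GRing.divring_closed D) (aD : forall c, a c \in D).

(** A D-linear form on L extends to an endomorphism of T that is linear over the span of D and maps
    T to this span. Its value at s kills y, because s does, and some form of a coordinate system
    adapted to s has a value that pi does not kill. *)
Lemma annihilator_descent s y : y \in left_span p q D -> s * y = 0 -> pi s != 0 ->
  exists x, [/\ x \in left_span p q D, x * y = 0 & pi x != 0].
Proof.
move=> Dy sy0 ps0; have [ab /(_ s)[t sE] univ] := hT.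
have [F FE] := finite_coordinates DD [seq i.1 | i <- t].
have /choice[h hE] (f : L * {l : L -> L | linear_form D l}) :
    exists h : {additive T -> T}, forall x y, h (p x * q y) = p (sval f.2 x) * q y.
  case: f => g [l [lD lZ lb]] /=.
  apply: univ; split=> [x x' z|x z z'|c x z]; rewrite ?lD ?rmorphD ?mulrDl ?mulrDr //.
  by rewrite [x * a c]mulrC lZ // !rmorphM ab; ring.
have hD f z : h f z \in left_span p q D.
  have [_ /(_ z)[r ->] _] := hT; rewrite raddf_sum.
  elim: r => [|i r IH]; first by rewrite big_nil left_span0.
  rewrite big_cons left_spanD // hE left_span_tens //.
  by case: (svalP f.2).
have hM f z w : w \in left_span p q D -> h f (z * w) = h f z * w.
  move: w; apply: left_spanP => [|u v hu hv|x w Dx].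
  - by rewrite !mulr0 raddf0.
  - by rewrite !mulrDr raddfD hu hv.
  have [_ /(_ z)[r ->] _] := hT; rewrite mulr_suml !raddf_sum mulr_suml.
  apply: eq_bigr => i _; rewrite mulrACA -!rmorphM !hE.
  by have [_ lZ _] := svalP f.2; rewrite [i.1 * x]mulrC lZ // !rmorphM; ring.
have [[f pf]|nf] := pselect (exists f, pi (h f s) != 0).
  by exists (h f s); split=> //; rewrite -hM // sy0 raddf0.
case/eqP: ps0; have -> : s = \sum_(f <- F) h f s * p f.1.
  transitivity (\sum_(f <- F) \sum_(i <- t) p (sval f.2 i.1 * f.1) * q i.2); last first.
    apply: eq_bigr => f _; rewrite [in RHS]sE raddf_sum mulr_suml.
    by apply: eq_bigr => i _; rewrite hE rmorphM; ring.
  rewrite exchange_big {1}sE big_seq [RHS]big_seq; apply: eq_bigr => i ti.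
  by rewrite -mulr_suml -rmorph_sum -FE // map_f.
rewrite rmorph_sum big1 // => f _; rewrite rmorphM.
have [->|pf] := eqVneq (pi (h f s)) 0; first by rewrite mul0r.
by case: nf; exists f.
Qed.

End Descent.

(** * Minimal primes and fields *)

Section QuotientDomain.
Local Open Scope quotient_scope.
Variables (A : comNzRingType) (P : prime_idealr A).

Definition quotient_domain := {ideal_quot P}.
HB.instance Definition _ := GRing.ComNzRing.on quotient_domain.

(** The fraction field is defined for rings with inverses, which are chosen here. *)
Definition quotient_unit : pred quotient_domain := fun x => `[< exists y, y * x = 1 >].
Definition quotient_inv (x : quotient_domain) : quotient_domain :=
  if pselect (exists y, y * x = 1) is left e then projT1 (cid e) else x.

Fact quotient_mulV : {in quotient_unit, left_inverse 1 quotient_inv *%R}.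
Proof.
move=> x /asboolP ex; rewrite /quotient_inv; case: pselect => // e.
exact: (projT2 (cid e)).
Qed.
Fact quotient_unitP x y : y * x = 1 -> quotient_unit x.
Proof. by move=> xy; apply/asboolP; exists y. Qed.
Fact quotient_inv_out : {in [predC quotient_unit], quotient_inv =1 id}.
Proof.
move=> x /negP nx; rewrite /quotient_inv; case: pselect => // e.
by case: nx; apply/asboolP.
Qed.
HB.instance Definition _ := GRing.ComNzRing_hasMulInverse.Build quotient_domain
  quotient_mulV quotient_unitP quotient_inv_out.

Fact quotient_integral : GRing.integral_domain_axiom quotient_domain.
Proof. exact: Quotient.rquot_IdomainAxiom. Qed.
HB.instance Definition _ := GRing.ComUnitRing_isIntegral.Build quotient_domain
  quotient_integral.

Lemma prime_ideal_field : exists (F : fieldType) (f : {rmorphism A -> F}),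
  forall x, (f x == 0) = (x \in P).
Proof.
pose f (x : A) : {fraction quotient_domain} :=
  FracField.tofrac (\pi_quotient_domain x : quotient_domain).
have fz : zmod_morphism f.
  by move=> x y; rewrite /f -tofracB; congr FracField.tofrac; rewrite !piE.
have fm : monoid_morphism f.
  split=> [|x y]; rewrite /f; first by rewrite -tofrac1; congr FracField.tofrac; rewrite !piE.
  by rewrite -tofracM; congr FracField.tofrac; rewrite !piE.
pose F : {rmorphism A -> {fraction quotient_domain}} := HB.pack f
  (GRing.isZmodMorphism.Build _ _ f fz) (GRing.isMonoidMorphism.Build _ _ f fm).
exists {fraction quotient_domain}, F => x /=.
rewrite /f tofrac_eq0.
by rewrite -[in RHS](subr0 x) Quotient.idealrBE !piE.
Qed.

End QuotientDomain.

(** Let M be a maximal multiplicative set that contains S0 and not 0. An element x that is not in M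
    satisfies s x^n = 0 for some s in M, since otherwise the products s x^n would form a larger
    set. Hence the complement of M is an ideal, and it is a minimal prime ideal. *)
Lemma minimal_prime_field (A : comNzRingType) (S0 : A -> Prop) :
  S0 1 -> (forall x y, S0 x -> S0 y -> S0 (x * y)) -> ~ S0 0 ->
  exists (F : fieldType) (f : {rmorphism A -> F}),
    (forall s, S0 s -> f s != 0) /\
    forall x, f x = 0 -> exists s n, f s != 0 /\ s * x ^+ n = 0.
Proof.
move=> S01 S0M S00.
pose mult (S : A -> Prop) := [/\ S 1, forall x y, S x -> S y -> S (x * y) & ~ S 0].
have [|G [X0 GX0] GP Gtot|M [[M1 MM M0] SM maxM]] := @maximal_set A mult S0; first by split.
  split; first by exists X0 => //; case: (GP _ GX0).
    move=> x y [X GX Xx] [Y GY Yy].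
    have [XY|YX] := Gtot _ _ GX GY.
      by exists Y => //; case: (GP _ GY) => _ YM _; apply: YM => //; exact: XY.
    by exists X => //; case: (GP _ GX) => _ XM _; apply: XM => //; exact: YX.
  by case=> X GX; case: (GP _ GX).
have Mexp x n : M x -> M (x ^+ n).
  by move=> Mx; elim: n => [|n IH]; rewrite ?expr0 // exprS; apply: MM.
have nM x : ~ M x -> exists s n, M s /\ s * x ^+ n = 0.
  move=> nMx; apply: contrapT => no; apply: nMx.
  apply: (maxM (fun z => exists s n, M s /\ z = s * x ^+ n)).
  - split; first by exists 1, 0; rewrite expr0 mulr1.
      move=> _ _ [s [n [Ms ->]]] [t [m [Mt ->]]]; exists (s * t), (n + m)%N.
      by rewrite exprD mulrACA; split=> //; apply: MM.
    by move=> [s [n [Ms E]]]; apply: no; exists s, n.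
  - by move=> z Mz; exists z, 0; rewrite expr0 mulr1.
  - by exists 1, 1%N; rewrite expr1 mul1r.
pose P : {pred A} := fun x => `[< ~ M x >].
have PE x s n : M s -> s * x ^+ n = 0 -> x \in P.
  by move=> Ms sx; apply/asboolP => Mx; apply: M0; rewrite -sx; apply: MM => //; exact: Mexp.
have Pid : idealr_closed P.
  split; first by apply/asboolP.
    by apply/negP => /asboolP.
  move=> c u v /asboolP/nM[s [n [Ms su]]] /asboolP/nM[t [m [Mt tv]]].
  apply: (@PE _ (s * t) (n + m)%N); first exact: MM.
  rewrite exprDn mulr_sumr big1 // => i _; rewrite mulrnAr.
  have [im|mi] := leqP m i.
    have -> : v ^+ i = v ^+ m * v ^+ (i - m) by rewrite -exprD subnKC.
    set w := _ ^+ (n + m - i); set r := v ^+ (i - m).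
    have -> : s * t * (w * (v ^+ m * r)) = s * w * r * (t * v ^+ m) by ring.
    by rewrite tv mulr0 mul0rn.
  have ni : (n <= n + m - i)%N.
    by rewrite leq_subRL ?[(i + n)%N]addnC ?leq_add2l ltnW // (leq_trans mi) ?leq_addl.
  have -> : (c * u) ^+ (n + m - i) = c ^+ n * u ^+ n * (c * u) ^+ (n + m - i - n).
    by rewrite -exprMn -exprD subnKC.
  set w := _ ^+ (n + m - i - n).
  have -> : s * t * (c ^+ n * u ^+ n * w * v ^+ i) = t * c ^+ n * w * v ^+ i * (s * u ^+ n).
    by ring.
  by rewrite su mulr0 mul0rn.
have Ppr : prime_idealr_closed P.
  move=> u v; apply: contraLR; rewrite negb_or => /andP[/asboolPn nu /asboolPn nv].
  by apply/asboolPn => nuv; apply: nuv; apply: MM; exact: contrapT.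
pose PI : prime_idealr A := HB.pack P (isIdealr.Build A P Pid)
  (isPrimeIdealrClosed.Build A P Ppr).
have [F [f fE]] := prime_ideal_field PI.
have fM x : f x != 0 <-> M x.
  rewrite fE; split=> [/asboolPn|Mx]; first exact: contrapT.
  by apply/asboolPn; apply.
exists F, f; split=> [s /SM /fM//|x /eqP fx].
have [|s [n [Ms sx]]] := nM x; first by move/fM; rewrite fx.
by exists s, n; split=> //; apply/fM.
Qed.

(** * Smith normal form over a valuation ring *)

Definition divides (R : comNzRingType) (a b : R) := exists c, b = c * a.

Section Smith.
Variable R : comUnitRingType.
Hypothesis tot : forall a b : R, divides a b \/ divides b a.

Lemma divides_refl (a : R) : divides a a. Proof. by exists 1; rewrite mul1r. Qed.
Lemma divides_trans (a b c : R) : divides a b -> divides b c -> divides a c.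
Proof. by move=> [x ->] [y ->]; exists (y * x); rewrite mulrA. Qed.

Lemma least_divisor (s : seq R) : s != [::] ->
  exists2 a, a \in s & forall b, b \in s -> divides a b.
Proof.
elim: s => // a s IH _; have [s0|/IH[c cs cP]] := eqVneq s [::].
  exists a; rewrite ?mem_head // => b; rewrite s0 mem_seq1 => /eqP->.
  exact: divides_refl.
have [ac|ca] := tot a c.
  exists a; rewrite ?mem_head // => b; rewrite inE => /predU1P[->|/cP]; first exact: divides_refl.
  exact: divides_trans.
exists c; first by rewrite inE cs orbT.
by move=> b; rewrite inE => /predU1P[->//|/cP].
Qed.

(** Among the entries of a matrix, one divides all the others; moved to the top left corner, it
    serves as pivot. *)
Lemma smith_form n (M : 'M[R]_n) : exists (P Q : 'M[R]_n) (d : 'rV[R]_n),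
  [/\ P \in unitmx, Q \in unitmx, M = P *m diag_mx d *m Q
    & forall i j : 'I_n, (i <= j)%N -> divides (d 0 i) (d 0 j)].
Proof.
elim: n M => [|n IH] M.
  exists 1%:M, 1%:M, 0; rewrite unitmx1; split=> // [|[]//].
  by apply/matrixP => -[].
have [|a /mapP[[i j] _ aE] aP] := @least_divisor [seq M ij.1 ij.2 | ij : 'I_n.+1 * 'I_n.+1].
  by rewrite -size_eq0 size_map -cardE card_prod card_ord.
pose N : 'M[R]_(1 + n) := xrow i 0 (xcol j 0 M).
have /choice[c cE] (kl : 'I_n.+1 * 'I_n.+1) : exists c, N kl.1 kl.2 = c * a.
  apply: aP; rewrite !mxE; apply/mapP.
  by exists (tperm i 0 kl.1, tperm j 0 kl.2); rewrite ?mem_enum.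
have N00 : N 0 0 = a by rewrite !mxE !tpermR aE.
pose C : 'M[R]_(1 + n) := \matrix_(k, l) c (k, l).
have NC : N = a *: C by apply/matrixP => k l; rewrite (cE (k, l)) !mxE mulrC.
have [P [Q [d [uP uQ CE dP]]]] := IH (drsubmx C - dlsubmx C *m ursubmx C).
have NE : N = block_mx 1%:M 0 (dlsubmx C) P *m diag_mx (row_mx a%:M (a *: d)) *m
              block_mx 1%:M (ursubmx C) 0 Q.
  rewrite diag_mx_row !mulmx_block !(mul0mx, mulmx0, mul1mx, addr0, add0r, mulmx1).
  have da : diag_mx (a%:M : 'M_1) = a%:M.
    by apply/matrixP => k l; rewrite !mxE !ord1.
  have dad : diag_mx (a *: d) = a *: diag_mx d.
    by apply/matrixP => k l; rewrite !mxE mulrnAr.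
  rewrite da dad mul_scalar_mx mul_mx_scalar -scalemxAl -scalemxAr -scalemxAl -CE.
  rewrite -scalerDr addrC subrK -[LHS]submxK {1 2 3 4}NC.
  congr block_mx; apply/matrixP => k l; rewrite !mxE //.
  have l0 : lshift n (0 : 'I_1) = 0 by apply: val_inj.
  by rewrite !ord1 eqxx mulr1n l0 mulrC -(cE (0, 0)).
pose tr := block_mx 1%:M 0 (dlsubmx C) P; pose tu := block_mx 1%:M (ursubmx C) 0 Q.
exists (tperm_mx i 0 *m tr), (tu *m tperm_mx j 0), (row_mx a%:M (a *: d)).
have u1 : tr \in unitmx by rewrite unitmxE det_lblock det1 mul1r -unitmxE.
have u2 : tu \in unitmx by rewrite unitmxE det_ublock det1 mul1r -unitmxE.
split; rewrite ?unitmx_mul ?unitmx_perm ?u1 ?u2 //.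
- have tt x : tperm_mx x 0 *m tperm_mx x 0 = 1%:M :> 'M[R]_(1 + n).
    by rewrite -perm_mxM tperm2 perm_mx1.
  transitivity (tperm_mx i 0 *m N *m tperm_mx j 0); last by rewrite NE !mulmxA.
  by rewrite /N xrowE xcolE !mulmxA tt mul1mx -mulmxA tt mulmx1.
- have Dl (k : 'I_1) : (row_mx a%:M (a *: d) : 'rV_(1 + n)) 0 (lshift n k) = a.
    by rewrite row_mxEl ord1 mxE eqxx mulr1n.
  have Dr k : (row_mx a%:M (a *: d) : 'rV_(1 + n)) 0 (rshift 1 k) = a * d 0 k.
    by rewrite row_mxEr mxE.
  move=> k l; case: (split_ordP (k : 'I_(1 + n))) => k' ->;
    case: (split_ordP (l : 'I_(1 + n))) => l' ->; rewrite ?Dl ?Dr.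
  + by move=> _; exact: divides_refl.
  + by move=> _; exists (d 0 l'); rewrite mulrC.
  + by rewrite /= ord1.
  + by rewrite leq_add2l => /dP[e ->]; exists e; rewrite mulrCA.
Qed.

End Smith.

(** * Adjoining one element to a valuation ring *)

Section SimpleExtension.
Variables (R : idomainType) (kappa : fieldType) (rho : {rmorphism R -> kappa}) (tau : kappa).
Hypothesis tot : forall a b : R, divides a b \/ divides b a.
Hypothesis rho_unit : forall a : R, rho a != 0 -> a \is a GRing.unit.

Local Notation bar := (map_poly rho).
Let ev : {rmorphism {poly R} -> kappa} := horner_eval tau \o bar.

Lemma evE h : ev h = (bar h).[tau]. Proof. by []. Qed.

(** The Gauss content: a least coefficient for divisibility, which leaves a coefficient 1. *)
Lemma content (h : {poly R}) : exists a h1, h = a *: h1 /\ bar h1 != 0.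
Proof.
have [->|h0] := eqVneq h 0.
  by exists 0, 1; rewrite scale0r rmorph1 oner_eq0.
have [|a ah aP] := least_divisor tot (s := h); first by rewrite -size_eq0 size_poly_eq0.
have [i si hi] : exists2 i, (i < size h)%N & h`_i = a by apply/(nthP 0).
have /choice[c cE] j : exists c, h`_j = c * a.
  have [sj|/(nth_default 0)->] := ltnP j (size h); last by exists 0; rewrite mul0r.
  by apply: aP; rewrite mem_nth.
have a0 : a != 0.
  apply: contraNneq h0 => a0; apply/eqP/polyP => j.
  by rewrite cE a0 mulr0 coef0.
exists a, (\poly_(j < size h) c j); split.
  apply/polyP => j; rewrite coefZ coef_poly.
  by case: ltnP => [_|/(nth_default 0)->]; rewrite ?mulr0 // cE mulrC.
have ci : c i = 1 by apply: (mulIf a0); rewrite -cE hi mul1r.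
apply/eqP => /polyP/(_ i)/eqP; rewrite coef_map coef_poly si ci /= rmorph1 coef0.
by rewrite oner_eq0.
Qed.

Variable f : {poly R}.
Hypothesis evf : ev f = 0.
Hypothesis locally_reduced : forall h, ev h = 0 ->
  exists s q, ev s != 0 /\ bar (s * h) = bar (f * q).

(** Here a polynomial that vanishes at tau after reduction has zero reduction. *)
Lemma transcendental_step (x : {poly R}) : f = 0 ->
  exists a s z q, [/\ ev s != 0, ev z != 0 & s * x = a%:P * z + f * q].
Proof.
move=> f0; have [a [z [xE z0]]] := content x.
exists a, 1, z, 0; split; first by rewrite rmorph1 oner_eq0.
  apply/eqP => /locally_reduced[s [q [s0 /eqP]]].
  rewrite f0 mul0r rmorph0 rmorphM mulf_eq0 (negPf z0) orbF => /eqP bs.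
  by case/eqP: s0; rewrite evE bs horner0.
by rewrite mulr0 addr0 mul1r xE mul_polyC.
Qed.

Hypothesis mf : f \is monic.

Let cong (u v : {poly R}) := exists q, u = v + f * q.

Let cong_trans u v w : cong u v -> cong v w -> cong u w.
Proof. by move=> [q ->] [r ->]; exists (r + q); rewrite mulrDr addrA. Qed.
Let cong_sym u v : cong u v -> cong v u.
Proof. by move=> [q ->]; exists (- q); rewrite mulrN addrK. Qed.
Let congM w u v : cong u v -> cong (w * u) (w * v).
Proof. by move=> [q ->]; exists (w * q); rewrite mulrDr mulrCA. Qed.
Let cong_sum (I : finType) (u v : I -> {poly R}) :
  (forall i, cong (u i) (v i)) -> cong (\sum_i u i) (\sum_i v i).
Proof.
move=> /choice[q qE]; exists (\sum_i q i).
by rewrite mulr_sumr -big_split; apply: eq_bigr => i _.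
Qed.
Let congB u v : cong u v -> cong (u - v) 0.
Proof. by move=> [q ->]; exists q; rewrite add0r addrC addKr. Qed.

Let n := (size f).-1.

Let size_f : size f = n.+1.
Proof. by rewrite /n prednK // size_poly_gt0 monic_neq0. Qed.

Let reduce w : exists c : 'rV_n, cong w (rVpoly c).
Proof.
exists (poly_rV (Pdiv.Ring.rmodp w f)), (Pdiv.Ring.rdivp w f).
rewrite poly_rV_K; last by rewrite -ltnS -size_f Pdiv.Ring.ltn_rmodpN0 ?monic_neq0.
by rewrite {1}(Pdiv.RingMonic.rdivp_eq mf w) addrC mulrC.
Qed.

Let small_multiple (S : idomainType) (g q : {poly S}) m (c : 'rV[S]_m) :
  g \is monic -> (m < size g)%N -> rVpoly c = g * q -> c = 0.
Proof.
move=> mg mlt cE; suff q0 : q = 0 by rewrite -[c]rVpolyK cE q0 mulr0 linear0.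
apply/eqP; apply: contraTT mlt => q0.
have gq : (size (g * q)%R <= m)%N by rewrite -cE size_poly.
rewrite -leqNgt; apply: leq_trans gq.
by rewrite size_monicM // -subn1 -addnBA ?leq_addr // size_poly_gt0.
Qed.

Let cong0 (c : 'rV_n) : cong (rVpoly c) 0 -> c = 0.
Proof. by move=> [q]; rewrite add0r; apply: small_multiple; rewrite ?size_f. Qed.

Let bar0 (c : 'rV_n) q : bar (rVpoly c) = bar (f * q) -> map_mx rho c = 0.
Proof.
rewrite map_rVpoly rmorphM; apply: small_multiple; first exact: monic_map.
by rewrite size_map_poly_id0 ?size_f //= (monicP mf) rmorph1 oner_eq0.
Qed.

Let rVsum m (c : 'rV[R]_m) (U : 'M[R]_(m, n)) :
  rVpoly (c *m U) = \sum_j (c 0 j)%:P * rVpoly (row j U).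
Proof.
rewrite mulmx_sum_row linear_sum; apply: eq_bigr => j _.
by rewrite linearZ /= mul_polyC.
Qed.

(** The kernel of evaluation at tau is, after reduction, generated by a monic polynomial h0 of least
    degree, whose multiplier works for all its multiples. *)
Let uniform_multiplier : exists2 g, ev g != 0 &
  forall h, ev h = 0 -> exists q, bar (g * h) = bar (f * q).
Proof.
pose P m := `[< exists h : {poly R}, [/\ h \is monic, size h = m & ev h = 0] >].
have [|m /asboolP[h0 [mh0 sh0 eh0]] minm] := @ex_minnP P.
  by exists (size f); apply/asboolP; exists f.
have [g [q0 [g0 gh0]]] := locally_reduced eh0.
exists g => // h eh.
pose r := Pdiv.Ring.rmodp h h0; pose q := Pdiv.Ring.rdivp h h0.
have hE : h = q * h0 + r by apply: Pdiv.RingMonic.rdivp_eq.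
have er : ev r = 0 by move: eh; rewrite hE rmorphD rmorphM eh0 mulr0 add0r.
suff r0 : bar r = 0.
  have br : bar (g * r) = 0 by rewrite rmorphM /= r0 mulr0.
  exists (q0 * q); rewrite hE mulrDr rmorphD /= br addr0.
  by rewrite [q * h0]mulrC !mulrA [LHS]rmorphM /= gh0 -rmorphM.
apply/eqP; apply: contraT => r0.
pose d := (size (bar r)).-1.
have sd : size (bar r) = d.+1 by rewrite /d prednK // size_poly_gt0.
have rd : rho r`_d != 0.
  by rewrite -coef_map /d -/(lead_coef _) lead_coef_eq0.
have ud := rho_unit rd.
pose t := (r`_d)^-1 *: take_poly d.+1 r.
have bt : bar t = (rho (r`_d)^-1) *: bar r.
  apply/polyP => i; rewrite coef_map !coefZ coef_map coef_take_poly /= rmorphM /=.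
  case: ltnP => // di; rewrite rmorph0; congr (_ * _).
  by rewrite -coef_map nth_default ?sd.
have et : ev t = 0 by rewrite evE bt hornerZ -evE er mulr0.
have td : t`_d = 1 by rewrite coefZ coef_take_poly ltnSn mulVr.
have st : size t = d.+1.
  apply/eqP; rewrite eqn_leq (leq_trans (size_scale_leq _ _)) ?size_take_poly //=.
  by rewrite ltnNge; apply: contra_eqN td => /leq_sizeP/(_ d (leqnn _))->; rewrite eq_sym oner_eq0.
have mt : t \is monic by rewrite monicE /lead_coef st td.
have := minm d.+1; rewrite -sd => /(_ _)/wrap[].
  by apply/asboolP; exists t; rewrite sd.
rewrite leqNgt => /negP[]; rewrite -sh0.
apply: leq_ltn_trans (Pdiv.Ring.ltn_rmodpN0 h (monic_neq0 mh0)).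
exact: size_poly.
Qed.

(** Put S = R[X]/(f), a free R-module of finite rank. Smith normal form applied to multiplication by
    x gives a basis b_j of S and elements d_j of R, each dividing the next, such that the
    y_j = d_j b_j generate the ideal x S over R. Let j0 be the first index with ev b_j0 <> 0; the
    content is a = d_j0. Indeed a b_j0 is a multiple of x. Conversely, let N be the image of x S
    in S/aS, generated over R by the y_j with d_j not divisible by a. Since g multiplies the
    kernel of ev into the ideal of S generated by the maximal ideal of R, the matrix of g on these
    generators is strictly triangular modulo this maximal ideal. The determinant trick then gives
    an element s that kills N and satisfies ev s <> 0. *)
Lemma algebraic_step (x : {poly R}) :
  exists a s z q, [/\ ev s != 0, ev z != 0 & s * x = a%:P * z + f * q].
Proof.
have [g g0 gP] := uniform_multiplier.
have /choice[m mE] (i : 'I_n) : exists c : 'rV_n, cong (x * 'X^i) (rVpoly c) by apply: reduce.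
pose M : 'M_n := \matrix_i m i.
have [P [U [d [uP uU ME dP]]]] := smith_form tot M.
pose b j := rVpoly (row j U); pose y j := (d 0 j)%:P * b j.
have xM (c : 'rV_n) : cong (x * rVpoly c) (rVpoly (c *m M)).
  rewrite rVsum; have -> : x * rVpoly c = \sum_j (c 0 j)%:P * (x * 'X^j).
    rewrite -{1}[c]mulmx1 rVsum mulr_sumr; apply: eq_bigr => j _.
    by rewrite mulrCA; congr (_ * (_ * _)); rewrite row1 rVpoly_delta.
  by apply: cong_sum => j; apply: congM; rewrite rowK.
have row_diag j : row j (diag_mx d *m U) = d 0 j *: row j U.
  by apply/rowP => l; rewrite mul_diag_mx !mxE.
have yE (c : 'rV_n) : rVpoly (c *m (diag_mx d *m U)) = \sum_j (c 0 j)%:P * y j.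
  rewrite rVsum; apply: eq_bigr => j _; congr (_ * _).
  by rewrite row_diag linearZ /y /= mul_polyC.
have ideal1 w : exists nu : 'rV_n, cong (w * x) (\sum_j (nu 0 j)%:P * y j).
  have [c cw] := reduce w; exists (c *m P).
  rewrite -yE mulmxA -(mulmxA c) -(mulmxA c) -ME mulrC.
  by apply: cong_trans (xM c); apply: congM.
have ideal2 j : exists w, cong (y j) (w * x).
  exists (rVpoly (row j (invmx P))); apply: cong_sym.
  have -> : y j = rVpoly (row j (invmx P) *m M).
    by rewrite -row_mul ME -mulmxA mulKmx // row_diag linearZ /y /= mul_polyC.
  by rewrite mulrC; apply: xM.
have basis w : exists mu : 'rV_n, cong w (\sum_j (mu 0 j)%:P * b j).
  by have [c cw] := reduce w; exists (c *m invmx U); rewrite -rVsum mulmxKV.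
(* Comparing the coordinates of g y_j in both generating families gives d_j mu_l = nu_l d_l. As
   d_l divides d_j for l <= j, nu_l is then a multiple of mu_l, which reduces to 0. *)
have kernel_row j : ev (b j) = 0 -> exists nu : 'rV_n,
    cong (g * y j) (\sum_l (nu 0 l)%:P * y l) /\
    forall l : 'I_n, (l <= j)%N -> d 0 j != 0 -> rho (nu 0 l) = 0.
  move=> bj0; have [mu muE] := basis (g * b j).
  have rmu : map_mx rho mu = 0.
    have [q1 q1E] := gP _ bj0; have [q2 q2E] := muE.
    have : map_mx rho (mu *m U) = 0.
      apply: (@bar0 _ (q1 - q2)); rewrite rVsum -[X in bar X](addrK (f * q2)) -q2E.
      by rewrite mulrBr !rmorphB /= q1E.
    rewrite map_mxM => /(congr1 (mulmx^~ (map_mx rho (invmx U)))).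
    by rewrite mul0mx -mulmxA -map_mxM mulmxV // map_mx1 mulmx1.
  have [w wE] := ideal2 j; have [nu nuE] := ideal1 (g * w).
  have gy : cong (g * y j) (\sum_l (nu 0 l)%:P * y l).
    by apply: cong_trans nuE; rewrite -mulrA; apply: congM.
  exists nu; split=> // l lj dj0.
  have : (nu *m diag_mx d - d 0 j *: mu) *m U = 0.
    apply: cong0; rewrite mulmxBl linearB /= -mulmxA yE -scalemxAl linearZ /= rVsum.
    apply: congB; apply: cong_sym; apply: cong_trans gy; apply: cong_sym.
    rewrite -mul_polyC /y mulrCA; exact: congM.
  move/(congr1 (mulmx^~ (invmx U))); rewrite mulmxK // mul0mx => /rowP/(_ l).
  rewrite mul_mx_diag !mxE => /eqP; rewrite subr_eq0 => /eqP nul.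
  have [c cE] := dP _ _ lj.
  have dl0 : d 0 l != 0 by apply: contraNneq dj0 => dl0; rewrite cE dl0 mulr0.
  have -> : nu 0 l = c * mu 0 l by apply: (mulIf dl0); rewrite nul cE mulrAC.
  by move/rowP: rmu => /(_ l); rewrite !mxE rmorphM => ->; rewrite mulr0.
have [j bj] : exists j, ev (b j) != 0.
  apply: contrapT => nb; have [mu [q qE]] := basis 1.
  have /eqP : ev 1 = 0.
    rewrite qE rmorphD rmorphM evf mul0r addr0 rmorph_sum big1 // => j _.
    rewrite rmorphM; have [->|bj] := eqVneq (ev (b j)) 0; first by rewrite mulr0.
    by case: nb; exists j.
  by rewrite rmorph1 oner_eq0.
have {j bj} [j0 bj0 j0min] := @arg_minnP _ j (fun j => ev (b j) != 0) (fun j => j : nat) bj.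
pose a := d 0 j0; pose J j := ~~ `[< divides a (d 0 j) >].
have JP j : J j -> [/\ (j < j0)%N, ev (b j) = 0 & d 0 j != 0].
  move=> /asboolPn nj; have jj0 : (j < j0)%N.
    by rewrite ltnNge; apply/negP => jj0; apply: nj; apply: dP.
  split=> //; last by apply: contra_notN nj => /eqP->; exists 0; rewrite mul0r.
  by apply/eqP; apply: contraTT jj0 => /j0min; rewrite leqNgt.
have /choice[nu nuE] j : exists nu : 'rV_n, J j ->
    cong (g * y j) (\sum_l (nu 0 l)%:P * y l) /\
    forall l : 'I_n, (l <= j)%N -> rho (nu 0 l) = 0.
  have [/JP[_ /kernel_row[nu [nu1 nu2]] dj]|] := boolP (J j); last by exists 0.
  by exists nu => _; split=> // l lj; apply: nu2.
(* The rows outside J say that y_j is a multiple of a; those in J say that g y_j is the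
   combination of the y_l with coefficients nu. *)
pose C : 'M[{poly R}]_n := \matrix_(j, l)
  (if J j then (j == l)%:R * g - (nu j 0 l)%:P else (j == l)%:R).
pose s := \det C.
have CY j : exists e q, \sum_l C j l * y l = a%:P * e + f * q.
  have sel (w : {poly R}) : \sum_l (j == l)%:R * w * y l = w * y j.
    rewrite (bigD1 j) //= eqxx mul1r big1 ?addr0 // => l lj.
    by rewrite eq_sym (negPf lj) !mul0r.
  have [Jj|nJj] := boolP (J j).
    have [[q qE] _] := nuE j Jj; exists 0, q; rewrite mulr0 add0r.
    transitivity (g * y j - \sum_l (nu j 0 l)%:P * y l); last by rewrite qE addrC addKr.
    rewrite -sel -sumrB; apply: eq_bigr => l _.
    by rewrite mxE Jj mulrBl.
  move: (nJj); rewrite negbK => /asboolP[c cE].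
  exists (c%:P * b j), 0; rewrite mulr0 addr0.
  transitivity (1 * y j); last by rewrite mul1r /y cE polyCM mulrCA mulrA.
  by rewrite -sel; apply: eq_bigr => l _; rewrite mxE (negPf nJj) mulr1.
have sy l : exists e q, s * y l = a%:P * e + f * q.
  have /choice[e eE] := CY; have {eE}/choice[q qE] := eE.
  pose Y : 'cV_n := \col_l y l.
  have CYE : C *m Y = a%:P *: (\col_j e j) + f *: (\col_j q j).
    by apply/colP => j; rewrite !mxE -qE; apply: eq_bigr => i _; rewrite [Y _ _]mxE.
  have : \adj C *m (C *m Y) = s *: Y by rewrite mulmxA mul_adj_mx mul_scalar_mx.
  rewrite CYE mulmxDr -!scalemxAr => /colP/(_ l); rewrite !mxE => <-.
  by eexists; eexists.
have s0 : ev s != 0.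
  rewrite -[ev s]det_map_mx -det_tr det_trig; last first.
    apply/is_trig_mxP => i j ij; rewrite !mxE.
    have ji : (j == i) = false by rewrite -val_eqE gtn_eqF.
    case: ifP => [Jj|_]; last by rewrite ji rmorph0.
    rewrite ji mul0r sub0r rmorphN evE map_polyC hornerC /=.
    by have [_ ->] := nuE j Jj; rewrite ?oppr0 // ltnW.
  apply/prodf_neq0 => i _; rewrite !mxE eqxx.
  case: ifP => [Ji|_]; last by rewrite rmorph1 oner_eq0.
  rewrite mul1r rmorphB [ev (_%:P)]evE map_polyC hornerC /=.
  by have [_ ->] := nuE i Ji; rewrite ?subr0.
have [z [q zE]] : exists z q, s * x = a%:P * z + f * q.
  have [mu [q qE]] := ideal1 1; have /choice[e eE] := sy; have {eE}/choice[r rE] := eE.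
  exists (\sum_j (mu 0 j)%:P * e j), (\sum_j (mu 0 j)%:P * r j + s * q).
  rewrite -[x]mul1r qE mulrDr mulrDr [f * (s * q)]mulrCA addrA; congr (_ + _).
  rewrite !mulr_sumr -big_split; apply: eq_bigr => j _ /=.
  by rewrite mulrCA rE mulrDr; congr (_ + _); rewrite mulrCA.
have [a0|a0] := eqVneq a 0.
  exists 0, s, 1, q; split=> //; first by rewrite rmorph1 oner_eq0.
  by rewrite zE a0 !mul0r.
exists a, s, z, q; split=> //.
have [w [r rE]] := ideal2 j0.
have [c [r' cE]] := reduce (s * b j0 - w * z).
(* Both a s b_j0 and a w z represent w s x, and S is torsion-free over R. *)
have c0 : a *: c = 0.
  apply: cong0; rewrite linearZ /=; exists (s * r + w * q - a%:P * r').
  have -> : rVpoly c = s * b j0 - w * z - f * r' by rewrite cE addrK.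
  rewrite -mul_polyC add0r !mulrBr [a%:P * (s * _)]mulrCA -/(y j0) rE.
  rewrite [s * (_ + _)]mulrDr [s * (w * x)]mulrCA zE; ring.
have {c0} c0 : c = 0.
  apply/rowP => i; move/rowP: c0 => /(_ i)/eqP; rewrite !mxE mulf_eq0 (negPf a0).
  by move/eqP.
have : ev s * ev (b j0) != 0 by rewrite mulf_neq0.
apply: contraNneq => ez0; apply/eqP.
have -> : ev s * ev (b j0) = ev (s * b j0 - w * z) by rewrite rmorphB !rmorphM ez0 mulr0 subr0.
by rewrite cE c0 linear0 add0r rmorphM evf mul0r.
Qed.

End SimpleExtension.

(** * Subrings of a field *)

Section Subdomain.
Variables (E : fieldType) (O : subringClosed E).

Definition subdomain := {x : E | x \in O}.
HB.instance Definition _ := SubType.on subdomain.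
HB.instance Definition _ := Choice.on subdomain.
HB.instance Definition _ := [SubChoice_isSubComNzRing of subdomain by <:].

Fact subdomain_valM (x y : subdomain) : val (x * y) = val x * val y.
Proof. exact: rmorphM. Qed.
Fact subdomain_val1 : val (1 : subdomain) = 1. Proof. exact: rmorph1. Qed.
Fact subdomain_val0 : val (0 : subdomain) = 0. Proof. exact: rmorph0. Qed.

Definition sub_unit : pred subdomain := fun x => (val x != 0) && ((val x)^-1 \in O).
Definition sub_inv (x : subdomain) : subdomain := insubd x (val x)^-1.

Fact sub_mulV : {in sub_unit, left_inverse 1 sub_inv *%R}.
Proof.
move=> x /andP[x0 xO]; apply: val_inj; rewrite subdomain_valM subdomain_val1 /sub_inv.
by rewrite val_insubd xO mulVf.
Qed.
Fact sub_unitP x y : y * x = 1 -> sub_unit x.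
Proof.
move=> /(congr1 val); rewrite subdomain_valM subdomain_val1 => yx.
have x0 : val x != 0 by apply: contra_eqN yx => /eqP->; rewrite mulr0 eq_sym oner_eq0.
by rewrite /sub_unit x0 -[(val x)^-1]mul1r -yx mulfK // (valP y).
Qed.
Fact sub_inv_out : {in [predC sub_unit], sub_inv =1 id}.
Proof.
move=> x; rewrite !inE negb_and negbK => h; apply: val_inj; rewrite /sub_inv val_insubd.
case: ifP => // xO; case/orP: h => [/eqP->|]; first by rewrite invr0.
by rewrite xO.
Qed.
HB.instance Definition _ := GRing.ComNzRing_hasMulInverse.Build subdomain
  sub_mulV sub_unitP sub_inv_out.

Fact sub_integral : GRing.integral_domain_axiom subdomain.
Proof.
move=> x y /(congr1 val)/eqP; rewrite subdomain_valM subdomain_val0 mulf_eq0.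
by rewrite -!(inj_eq val_inj) subdomain_val0.
Qed.
HB.instance Definition _ := GRing.ComUnitRing_isIntegral.Build subdomain sub_integral.

Lemma subdomain_unitE (x : subdomain) :
  (x \is a GRing.unit) = (val x != 0) && ((val x)^-1 \in O).
Proof. by []. Qed.

Lemma subdomain_rmorph (A : comPzRingType) (f : {rmorphism A -> E}) :
  (forall x, f x \in O) ->
  exists g : {rmorphism A -> subdomain}, forall x, val (g x) = f x.
Proof.
move=> fO; pose g x : subdomain := Sub (f x) (fO x).
have gz : zmod_morphism g by move=> x y; apply: val_inj; rewrite [RHS]rmorphB /= rmorphB.
have gm : monoid_morphism g.
  split=> [|x y]; apply: val_inj; first by rewrite subdomain_val1 /= rmorph1.
  by rewrite subdomain_valM /= rmorphM.
pose G : {rmorphism A -> subdomain} := HB.pack g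
  (GRing.isZmodMorphism.Build _ _ g gz) (GRing.isMonoidMorphism.Build _ _ g gm).
by exists G.
Qed.

End Subdomain.

(** The form in which total divisibility enters the definition of valuation rings. *)
Lemma fraction_divides (R : idomainType) :
  (forall a b : R, divides a b \/ divides b a) ->
  forall x : {fraction R}, (exists a : R, x = FracField.tofrac a) \/
    (exists a : R, x^-1 = FracField.tofrac a).
Proof.
move=> tot x; have y0 := denom_ratioP (repr x).
have -> : x = FracField.tofrac \n_(repr x) / FracField.tofrac \d_(repr x).
  apply/esym/(canLR (mulfK _)); first by rewrite tofrac_eq0.
  rewrite -[X in X * _](@reprK _ _ x); unlock FracField.tofrac.
  rewrite -[RHS]FracField.pi_mul; apply/eqmodP.
  by rewrite /= FracField.equivfE /FracField.mulf !numden_Ratio ?mulr1 ?oner_neq0 // mul1r.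
have [->|x0] := eqVneq \n_(repr x) 0; first by left; exists 0; rewrite tofrac0 mul0r.
have [[c E]|[c E]] := tot \n_(repr x) \d_(repr x); [right|left]; exists c.
  by rewrite invf_div E tofracM mulfK // tofrac_eq0.
by rewrite E tofracM mulfK // tofrac_eq0.
Qed.

(** * The local ring of a place *)

Section Place.
Variables (A : comNzRingType) (E kappa : fieldType).
Variables (eps : {rmorphism A -> E}) (pi : {rmorphism A -> kappa}).
Hypothesis eps_pi : forall x, eps x = 0 -> pi x = 0.
Variable S : subringClosed A.

(** The image in E of the localization of S at the kernel of pi. *)
Definition local_pred : {pred E} := fun z =>
  `[< exists x y, [/\ x \in S, y \in S, pi y != 0 & z = eps x / eps y] >].

Let eps0 x : pi x != 0 -> eps x != 0.
Proof. by apply: contra_neq; exact: eps_pi. Qed.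

Fact local_pred_subring : GRing.subring_closed local_pred.
Proof.
split.
- by apply/asboolP; exists 1, 1; rewrite !rpred1 !rmorph1 oner_eq0 divr1.
- move=> _ _ /asboolP[x [y [Sx Sy py ->]]] /asboolP[u [v [Su Sv pv ->]]].
  apply/asboolP; exists (x * v - u * y), (y * v).
  rewrite rpredB ?rpredM // rmorphM mulf_neq0 //; split=> //.
  have [yn vn] := (eps0 py, eps0 pv).
  by rewrite rmorphB !rmorphM; field; rewrite yn vn.
- move=> _ _ /asboolP[x [y [Sx Sy py ->]]] /asboolP[u [v [Su Sv pv ->]]].
  apply/asboolP; exists (x * u), (y * v).
  by rewrite !rpredM // !rmorphM mulf_neq0 // mulf_div.
Qed.
HB.instance Definition _ := GRing.isSubringClosed.Build E local_pred local_pred_subring.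

(** Binds the proof that this is a subring, which depends on the hypotheses on eps and pi. *)
Definition local_subring : subringClosed E := local_pred.
Local Notation local_ring := (subdomain local_subring).

Lemma local_ringP (r : local_ring) :
  exists x y, [/\ x \in S, y \in S, pi y != 0 & val r = eps x / eps y].
Proof. exact/asboolP/(valP r). Qed.

Lemma local_ring_frac x y : x \in S -> y \in S -> pi y != 0 ->
  exists r : local_ring, val r = eps x / eps y.
Proof.
move=> Sx Sy py; have O : eps x / eps y \in local_subring by apply/asboolP; exists x, y.
by exists (exist (fun z => z \in local_subring) _ O).
Qed.

Lemma local_ring_elt x : x \in S -> exists r : local_ring, val r = eps x.
Proof.
move=> Sx; have [||r rE] := @local_ring_frac x 1 Sx; rewrite ?rpred1 ?rmorph1 ?oner_eq0 //.
by exists r; rewrite rE rmorph1 divr1.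
Qed.

(** Equality of two fractions in E gives equality of their images under pi, as elements killed by
    eps are killed by pi. *)
Lemma local_ring_residue : exists rho : {rmorphism local_ring -> kappa},
  forall (r : local_ring) x y, pi y != 0 -> val r = eps x / eps y -> rho r = pi x / pi y.
Proof.
have /choice[f fE] (r : local_ring) : exists u : kappa,
    forall x y, pi y != 0 -> val r = eps x / eps y -> u = pi x / pi y.
  have [x [y [_ _ py rE]]] := local_ringP r; exists (pi x / pi y) => u v pv.
  rewrite rE => /eqP; rewrite eqr_div ?eps0 // -!rmorphM -subr_eq0 -rmorphB => /eqP/eps_pi/eqP.
  by rewrite rmorphB subr_eq0 !rmorphM -eqr_div // => /eqP.
have fz : zmod_morphism f.
  move=> r s; have [x [y [_ _ py rE]]] := local_ringP r.
  have [u [v [_ _ pv sE]]] := local_ringP s.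
  rewrite (fE _ _ _ py rE) (fE _ _ _ pv sE) (fE (r - s) (x * v - u * y) (y * v)).
  - by rewrite rmorphB !rmorphM; field; rewrite py pv.
  - by rewrite rmorphM mulf_neq0.
  - have [yn vn] := (eps0 py, eps0 pv).
    by rewrite [LHS]rmorphB /= rE sE rmorphB !rmorphM; field; rewrite yn vn.
have fm : monoid_morphism f.
  split=> [|r s].
    rewrite (fE 1 1 1) ?rmorph1 ?oner_eq0 ?divr1 //.
  have [x [y [_ _ py rE]]] := local_ringP r.
  have [u [v [_ _ pv sE]]] := local_ringP s.
  rewrite (fE _ _ _ py rE) (fE _ _ _ pv sE) (fE (r * s) (x * u) (y * v)).
  - by rewrite !rmorphM mulf_div.
  - by rewrite rmorphM mulf_neq0.
  - by rewrite [LHS]subdomain_valM /= rE sE !rmorphM mulf_div.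
pose F : {rmorphism local_ring -> kappa} := HB.pack f
  (GRing.isZmodMorphism.Build _ _ f fz) (GRing.isMonoidMorphism.Build _ _ f fm).
by exists F => r x y py; exact: fE.
Qed.

Lemma local_ring_unit (r : local_ring) x y : x \in S -> y \in S ->
  pi x != 0 -> pi y != 0 -> val r = eps x / eps y -> r \is a GRing.unit.
Proof.
move=> Sx Sy px py rE; rewrite subdomain_unitE rE mulf_neq0 ?invr_eq0 ?eps0 //=.
by rewrite invf_div; apply/asboolP; exists y, x.
Qed.

Variables (V : valuationRingType) (vA : {rmorphism V -> A}).

(** Up to factors outside the kernel of pi, every element of S is a scalar of V. *)
Definition has_content := forall x, x \in S -> exists a s z,
  [/\ s \in S, z \in S, pi s != 0, pi z != 0 & eps (s * x) = eps (vA a * z)].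

Hypothesis content_S : has_content.

Lemma local_ring_content (r : local_ring) : exists a x y,
  [/\ x \in S, y \in S, pi x != 0, pi y != 0 & val r = eps (vA a) * (eps x / eps y)].
Proof.
have [x [y [Sx Sy py rE]]] := local_ringP r.
have [a [s [z [Ss Sz ps pz sx]]]] := content_S Sx.
exists a, z, (s * y); rewrite rpredM // rmorphM mulf_neq0 //; split=> //.
apply: (mulIf (eps0 ps)); rewrite rE rmorphM.
have {}sx : eps s * eps x = eps (vA a) * eps z by rewrite -rmorphM sx rmorphM.
have [h1 h2] := (eps0 ps, eps0 py).
by rewrite mulrAC [eps x * _]mulrC sx; field; rewrite h1 h2.
Qed.

Hypothesis vS : forall a, vA a \in S.

Lemma local_ring_divides (r s : local_ring) : divides r s \/ divides s r.
Proof.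
wlog: r s / exists a b x y u v, [/\ x \in S, y \in S, u \in S & v \in S] /\
   [/\ pi x != 0, pi y != 0, pi u != 0 & pi v != 0] /\
   [/\ val r = eps (vA a) * (eps x / eps y), val s = eps (vA b) * (eps u / eps v) &
       exists c, b = c * a].
  move=> main; have [a [x [y [Sx Sy px py rE]]]] := local_ring_content r.
  have [b [u [v [Su Sv pu pv sE]]]] := local_ring_content s.
  have [ab|ba] := valring_dvd a b.
    by apply/or_comm; apply: main; exists b, a, u, v, x, y.
  by apply: main; exists a, b, x, y, u, v.
move=> [a [b [x [y [u [v [[Sx Sy Su Sv] [[px py pu pv] [rE sE [c cE]]]]]]]]]]; left.
have [|||t tE] := @local_ring_frac (vA c * (u * y)) (v * x); rewrite ?rpredM //.
  by rewrite rmorphM mulf_neq0.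
exists t; apply: val_inj; rewrite [RHS]subdomain_valM /= tE rE sE cE !rmorphM.
have [h1 h2 h3 h4] := And4 (eps0 px) (eps0 py) (eps0 pu) (eps0 pv).
by field; rewrite h1 h2 h4.
Qed.

End Place.

(** * Adjoining one element to a subfield *)

(** Division with remainder by a monic polynomial does not leave a subring of coefficients. *)
Lemma polyOver_division (B : comNzRingType) (S : subringClosed B) (g : {poly B}) :
  g \is monic -> g \is a polyOver S -> forall p, p \is a polyOver S ->
  exists q r, [/\ q \is a polyOver S, r \is a polyOver S, p = q * g + r & (size r < size g)%N].
Proof.
move=> mg Sg; have g0 : (0 < size g)%N by rewrite size_poly_gt0 monic_neq0.
elim/poly_ind => [|p c IH] Sp.
  by exists 0, 0; rewrite rpred0 mul0r addr0 size_poly0.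
have Sc : c \in S by have := polyOverP Sp 0; rewrite coefD coefMX coefC /= add0r.
have [|q [r [Sq Sr pE sr]]] := IH.
  apply/polyOverP => i; have := polyOverP Sp i.+1.
  by rewrite coefD coefMX coefC /= addr0.
pose n := (size g).-1; have sg : size g = n.+1 by rewrite prednK.
pose t := r * 'X + c%:P; pose l := t`_n.
have St : t \is a polyOver S by rewrite rpredD ?rpredM ?polyOverX ?polyOverC.
have Sl : l \in S by exact/polyOverP.
exists (q * 'X + l%:P), (t - l%:P * g); split.
- by rewrite rpredD ?rpredM ?polyOverX ?polyOverC.
- by rewrite rpredB ?rpredM ?polyOverC.
- by rewrite pE /t; ring.
rewrite sg ltnS; apply/leq_sizeP => i; rewrite coefB coefCM leq_eqVlt => /predU1P[<-|ni].
  by have /monicP := mg; rewrite /lead_coef sg => ->; rewrite mulr1 subrr.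
rewrite [g`_i]nth_default ?sg // mulr0 subr0 coefD coefMX coefC.
case: i ni => // i ni; rewrite addr0 /= nth_default //.
by move: sr; rewrite sg ltnS => /leq_trans; apply.
Qed.

Section Span.
Variables (L : comNzRingType) (B T : comNzRingType).
Variables (p : {rmorphism L -> T}) (q : {rmorphism B -> T}).
HB.instance Definition _ (D : subringClosed L) := GRing.isSubringClosed.Build T
  (left_span p q D) (left_span_subring p q (GRing.subringClosedP D)).
End Span.

Section Adjoin.
Variables (L : fieldType) (D : divringClosed L) (t : L).

Definition adjoin : {pred L} := fun x =>
  `[< exists P Q : {poly L}, [/\ P \is a polyOver D, Q \is a polyOver D & x = P.[t] / Q.[t]] >].

Fact adjoin_divring : GRing.divring_closed adjoin.
Proof.
split.
- by apply/asboolP; exists 1, 1; rewrite !rpred1 hornerC divr1.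
- move=> _ _ /asboolP[P [Q [DP DQ ->]]] /asboolP[P' [Q' [DP' DQ' ->]]]; apply/asboolP.
  have [Q0|Q0] := eqVneq Q.[t] 0.
    by exists (- P'), Q'; rewrite rpredN Q0 invr0 mulr0 sub0r hornerN mulNr.
  have [Q'0|Q'0] := eqVneq Q'.[t] 0.
    by exists P, Q; rewrite Q'0 invr0 mulr0 subr0.
  exists (P * Q' - P' * Q), (Q * Q'); rewrite rpredB ?rpredM //; split=> //.
  by rewrite !hornerE; field; rewrite Q0 Q'0.
- move=> _ _ /asboolP[P [Q [DP DQ ->]]] /asboolP[P' [Q' [DP' DQ' ->]]]; apply/asboolP.
  exists (P * Q'), (Q * P'); rewrite !rpredM //; split=> //.
  by rewrite !hornerE invf_div mulf_div.
Qed.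
HB.instance Definition _ := GRing.isDivringClosed.Build L adjoin adjoin_divring.

Lemma adjoin_gen : t \in adjoin.
Proof. by apply/asboolP; exists 'X, 1; rewrite polyOverX rpred1 !hornerE divr1. Qed.

Lemma adjoin_base : {subset D <= adjoin}.
Proof.
move=> c Dc; apply/asboolP; exists c%:P, 1.
by rewrite polyOverC Dc rpred1 !hornerE divr1.
Qed.

Lemma adjoin_poly P : P \is a polyOver D -> P.[t] \in adjoin.
Proof. by move=> DP; apply/asboolP; exists P, 1; rewrite rpred1 hornerC divr1. Qed.

(** The coefficients in D(t) are fractions in t over D, and a common denominator turns an element
    of the tensor product into a polynomial expression in t. *)
Lemma clear_denominators (B T : comNzRingType)
    (p : {rmorphism L -> T}) (q : {rmorphism B -> T}) x :
  x \in left_span p q adjoin -> exists d P, [/\ d \is a polyOver D, d.[t] != 0,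
    P \is a polyOver (left_span p q D) & p d.[t] * x = P.[p t]].
Proof.
have lift (d : {poly L}) : d \is a polyOver D -> map_poly p d \is a polyOver (left_span p q D).
  move=> Dd; apply/polyOverP => i; rewrite coef_map /= -[p _]mulr1 -(rmorph1 q).
  by apply: left_span_tens; apply/polyOverP.
move: x; apply: left_spanP.
- by exists 1, 0; rewrite !rpred1 hornerC oner_eq0 rpred0 horner0 mulr0.
- move=> x y [d [P [Dd d0 SP xE]]] [e [Q [De e0 SQ yE]]].
  exists (d * e), (map_poly p e * P + map_poly p d * Q).
  rewrite hornerM mulf_neq0 // rpredM // rpredD ?rpredM ?lift //; split=> //.
  by rewrite hornerD !hornerM !horner_map /= -xE -yE rmorphM; ring.
- move=> _ y /asboolP[P [Q [DP DQ ->]]].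
  have [Q0|Q0] := eqVneq Q.[t] 0.
    exists 1, 0; rewrite !rpred1 hornerC oner_eq0 rpred0.
    by rewrite Q0 invr0 mulr0 rmorph0 mul0r horner0 mulr0.
  exists Q, (map_poly p P * (q y)%:P); split=> //.
    rewrite rpredM ?lift // polyOverC -[q y]mul1r -(rmorph1 p).
    by apply: left_span_tens; apply: rpred1.
  by rewrite hornerM hornerC horner_map /= mulrA -rmorphM [Q.[t] * _]mulrC divfK.
Qed.

(** The value f = 0 covers the case where t is transcendental over D; the last clause says that
    powers of t below the degree of f, or all powers if f = 0, are independent over D. *)
Lemma minimal_polynomial : exists f : {poly L},
  [/\ f \is a polyOver D, f.[t] = 0, f = 0 \/ f \is monic
    & forall r, r \is a polyOver D -> r.[t] = 0 -> f = 0 \/ (size r < size f)%N -> r = 0].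
Proof.
pose P n := `[< exists f, [/\ f \is a polyOver D, f != 0, f.[t] = 0 & size f = n] >].
have [[n Pn]|noP] := pselect (exists n, P n); last first.
  exists 0; rewrite rpred0 horner0; split=> //; first by left.
  move=> r Dr rt _; apply/eqP; apply: contraPT (noP) => r0.
  by case; exists (size r); apply/asboolP; exists r.
have [m /asboolP[f [Df f0 ft sf]] minm] := ex_minnP (ex_intro _ n Pn).
exists ((lead_coef f)^-1 *: f); rewrite hornerZ ft mulr0.
have lf0 : (lead_coef f)^-1 != 0 by rewrite invr_eq0 lead_coef_eq0.
split=> //.
- by rewrite polyOverZ // rpredV; apply/polyOverP.
- by right; rewrite monicE lead_coefZ mulVf // lead_coef_eq0.
- move=> r Dr rt; rewrite size_scale // sf => -[/eqP|].
    by rewrite scaler_eq0 (negPf lf0) (negPf f0).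
  rewrite ltnNge => h; apply/eqP; apply: contraNT h => r0.
  by apply: minm; apply/asboolP; exists r.
Qed.

End Adjoin.

(** * Contents along a tower of simple extensions *)

Section Tower.
Variables (k : fieldType) (V : valuationRingType) (kV : {rmorphism k -> V}).
Variables (k' : fieldType) (kk' : {rmorphism k -> k'}).
Variables (A B : comNzRingType).
Variables (cA : {rmorphism k' -> A}) (vA : {rmorphism V -> A}).
Variables (cB : {rmorphism k' -> B}) (yB : {rmorphism residue_field V -> B}).
Hypothesis hA : is_tensor kk' kV cA vA.
Hypothesis hB : is_tensor kk' (@residue V \o kV) cB yB.
Variable bar : {rmorphism A -> B}.
Hypotheses (bar_c : forall c, bar (cA c) = cB c) (bar_v : forall v, bar (vA v) = yB (residue v)).
Variables (E kappa : fieldType) (eps : {rmorphism A -> E}) (piB : {rmorphism B -> kappa}).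
Hypothesis piB_minimal : forall y, piB y = 0 -> exists s, piB s != 0 /\ s * y = 0.
Let pi : {rmorphism A -> kappa} := piB \o bar.
Hypothesis eps_pi : forall x, eps x = 0 -> pi x = 0.

Local Notation SA D := (left_span cA vA D).
Local Notation SB D := (left_span cB yB D).

Lemma bar_span (D : {pred k'}) x : x \in SA D -> bar x \in SB D.
Proof.
move: x; apply: left_spanP => [|x y hx hy|c v Dc]; first by rewrite rmorph0 left_span0.
  by rewrite rmorphD left_spanD.
by rewrite rmorphM bar_c bar_v left_span_tens.
Qed.

(** The residue map of V is surjective. *)
Lemma bar_surj (D : {pred k'}) y : y \in SB D -> exists2 x, x \in SA D & bar x = y.
Proof.
move: y; apply: left_spanP => [|_ _ [x Dx <-] [y Dy <-]|c z Dc].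
- by exists 0; rewrite ?rmorph0 ?left_span0.
- by exists (x + y); rewrite ?rmorphD ?left_spanD.
- have [v ->] := residueP z; exists (cA c * vA v); first exact: left_span_tens.
  by rewrite rmorphM bar_c bar_v.
Qed.

Section Step.
Variables (D : divringClosed k') (t : k').
Hypothesis kD : forall c, kk' c \in D.
Hypothesis goodD : has_content eps pi (SA D) vA.

Local Notation D' := (adjoin D t).
Local Notation R := (subdomain (local_subring eps_pi (SA D))).

(** Linear forms on the residue field over k turn r into polynomials over D that vanish at t, and
    r is zero if these polynomials are. *)
Lemma vanishing_combination (f : {poly k'}) r :
  (forall s, s \is a polyOver D -> s.[t] = 0 -> f = 0 \/ (size s < size f)%N -> s = 0) ->
  r \is a polyOver (SB D) -> r.[cB t] = 0 -> f = 0 \/ (size r < size f)%N -> r = 0.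
Proof.
move=> fmin Dr rt rf; apply/polyP => i; rewrite coef0.
have [F ->] := right_coordinates hB r`_i.
rewrite big1 // => -[g [h hh]] _ /=.
suff -> : h r`_i = 0 by rewrite rmorph0 mul0r.
rewrite -coef_map; suff -> : map_poly h r = 0 by rewrite coef0.
apply: fmin.
- apply/polyOverP => j; rewrite coef_map.
  by apply: (right_form_span hh (GRing.subringClosedP D)) => //; apply/polyOverP.
- have -> : (map_poly h r).[t] = h r.[cB t]; last by rewrite rt raddf0.
  rewrite (horner_coef_wide _ (size_poly _ _)) horner_coef raddf_sum.
  apply: eq_bigr => j _; rewrite coef_map /= -rmorphXn mulrC.
  by rewrite [in RHS]mulrC (right_formM hB).
- by case: rf => [|rf]; [left | right; apply: leq_ltn_trans rf; apply: size_poly].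
Qed.

Lemma lift_poly (p : {poly B}) : p \is a polyOver (SB D) ->
  exists2 P : {poly A}, P \is a polyOver (SA D) & map_poly bar P = p.
Proof.
elim/poly_ind: p => [|p c IH] Sp; first by exists 0; rewrite ?rpred0 ?rmorph0.
have Sc : c \in SB D by have := polyOverP Sp 0; rewrite coefD coefMX coefC /= add0r.
have [|P SP PE] := IH.
  apply/polyOverP => i; have := polyOverP Sp i.+1.
  by rewrite coefD coefMX coefC /= addr0.
have [x Sx xE] := bar_surj Sc; exists (P * 'X + x%:P).
  by rewrite rpredD ?rpredM ?polyOverX ?polyOverC.
by rewrite rmorphD rmorphM /= PE map_polyX map_polyC /= xE.
Qed.

Section WithResidue.
Variable rho : {rmorphism R -> kappa}.
Hypothesis rhoE : forall (r : R) x y, pi y != 0 -> val r = eps x / eps y -> rho r = pi x / pi y.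

Variable v : {rmorphism R -> E}.
Hypothesis vE : forall r, v r = val r.

Let pi0 x : pi x != 0 -> eps x != 0.
Proof. by apply: contra_neq; exact: eps_pi. Qed.

Lemma lift_local (P : {poly A}) : P \is a polyOver (SA D) ->
  exists X : {poly R}, map_poly v X = map_poly eps P /\ map_poly rho X = map_poly pi P.
Proof.
elim/poly_ind: P => [|p c IH] Sp; first by exists 0; rewrite !rmorph0.
have Sc : c \in SA D by have := polyOverP Sp 0; rewrite coefD coefMX coefC /= add0r.
have [|X [XE XE']] := IH.
  apply/polyOverP => i; have := polyOverP Sp i.+1.
  by rewrite coefD coefMX coefC /= addr0.
have [r rE] := local_ring_elt eps_pi Sc; exists (X * 'X + r%:P).
rewrite !rmorphD !rmorphM /= XE XE' !map_polyX !map_polyC /=.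
have rc : rho r = piB (bar c).
  by rewrite (@rhoE r c 1) ?rmorph1 ?oner_eq0 ?divr1.
by rewrite rc vE rE.
Qed.

Lemma local_denominators (h : {poly R}) : exists w u,
  [/\ w \in SA D, pi w != 0, u \is a polyOver (SA D),
      eps w *: map_poly v h = map_poly eps u & pi w *: map_poly rho h = map_poly pi u].
Proof.
elim/poly_ind: h => [|h c [w [u [Sw pw Su uE uE']]]].
  by exists 1, 0; rewrite rpred1 rmorph1 oner_eq0 rpred0 !rmorph0 !scaler0.
have [x [y [Sx Sy py cE]]] := local_ringP c.
exists (w * y), (u * 'X * y%:P + (w * x)%:P).
rewrite rpredM // rmorphM mulf_neq0 // rpredD ?rpredM ?polyOverX ?polyOverC ?rpredM //.
rewrite !rmorphD !rmorphM /= !map_polyX !map_polyC /= -uE -uE' -!mul_polyC !rmorphM /=.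
have vc : v c = eps x / eps y by rewrite vE.
have rc := rhoE py cE.
split=> //.
  have -> : (eps x)%:P = (eps y)%:P * (v c)%:P by rewrite -polyCM vc mulrC divfK ?pi0.
  by ring.
have -> : (piB (bar x))%:P = (piB (bar y))%:P * (rho c)%:P by rewrite -polyCM rc mulrC divfK.
by ring.
Qed.

End WithResidue.

(** The hypothesis on polynomials that vanish at tau in the study of a simple extension comes from
    minimality of the prime: the annihilator of h(t) descends to the span of D(t), and is there,
    up to a denominator, the value at t of a polynomial sg. The product of sg and h vanishes at t,
    so it is a multiple of f0. *)
Lemma content_adjoin : has_content eps pi (SA D') vA.
Proof.
have [rho rhoE] := local_ring_residue eps_pi (SA D).
have [v vE] : exists v : {rmorphism R -> E}, forall r, v r = val r by exists val.
have vinj : injective v by move=> r s; rewrite !vE => /val_inj.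
have pi0 x : pi x != 0 -> eps x != 0 by apply: contra_neq; exact: eps_pi.
have pic c : c != 0 -> piB (cB c) != 0.
  by move=> c0; rewrite -[piB _]/((piB \o cB) c) fmorph_eq0.
have vS a : vA a \in SA D.
  by rewrite -[vA a]mul1r -(rmorph1 cA) left_span_tens ?rpred1.
have cS c : c \in D -> cA c \in SA D.
  by move=> Dc; rewrite -[cA c]mulr1 -(rmorph1 vA) left_span_tens.
have SS : {subset SA D <= SA D'} by apply: left_spanS; apply: adjoin_base.
have tS : cA t \in SA D'.
  by rewrite -[cA t]mulr1 -(rmorph1 vA) left_span_tens // adjoin_gen.
have polyS (P : {poly A}) : P \is a polyOver (SA D) -> P.[cA t] \in SA D'.
  move=> SP; apply: rpred_horner => //; apply/polyOverP => i; apply: SS.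
  exact/polyOverP.
have [f0 [Df0 f0t f0m f0min]] := minimal_polynomial D t.
have [f [fv frho]] : exists f : {poly R},
    map_poly v f = map_poly eps (map_poly cA f0) /\ map_poly rho f = map_poly pi (map_poly cA f0).
  apply: (lift_local rhoE vE) => //; apply/polyOverP => i; rewrite coef_map; apply: cS.
  exact/polyOverP.
pose tau := pi (cA t).
have evf : (map_poly rho f).[tau] = 0.
  by rewrite frho horner_map /= horner_map /= f0t !rmorph0.
have vf : (map_poly v f).[eps (cA t)] = 0.
  by rewrite fv horner_map /= horner_map /= f0t !rmorph0.
have fm : f = 0 \/ f \is monic.
  case: f0m => [f00|mf0]; [left|right].
    by apply: (map_inj_poly vinj (rmorph0 v)); rewrite fv f00 !rmorph0.
  have : map_poly v f \is monic by rewrite fv !monic_map.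
  by rewrite !monicE (lead_coef_map_inj vinj (rmorph0 v)) -(rmorph1 v) (inj_eq vinj).
have rho_unit (r : R) : rho r != 0 -> r \is a GRing.unit.
  have [x [y [Sx Sy py rE]]] := local_ringP r.
  rewrite (rhoE _ _ _ py rE) => rn0; apply: (local_ring_unit Sx Sy) => //.
  by apply: contraNneq rn0 => ->; rewrite mul0r.
have tot (r s : R) : divides r s \/ divides s r by apply: (local_ring_divides goodD).
(* The computation takes place over B; the polynomials found there are lifted to A, then to R. *)
have reduced_here (h : {poly R}) : (map_poly rho h).[tau] = 0 ->
    exists s q, (map_poly rho s).[tau] != 0 /\ map_poly rho (s * h) = map_poly rho (f * q).
  move=> evh; have [w [u [Sw pw Su uv urho]]] := local_denominators rhoE vE h.
  have [s [s0 sy]] : exists s, piB s != 0 /\ s * bar u.[cA t] = 0.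
    apply: piB_minimal; rewrite -[LHS]/(pi u.[cA t]) -horner_map /= -urho hornerZ.
    by rewrite evh mulr0.
  have Sy : bar u.[cA t] \in SB D' by apply: bar_span; apply: polyS.
  have kD' c : kk' c \in D' by apply: adjoin_base.
  have [x [Sx xy px]] := annihilator_descent hB (GRing.divringClosedP D') kD' Sy sy s0.
  have [d [sg [Dd d0 Ssg sgE]]] := clear_denominators Sx.
  pose ub := map_poly bar u.
  have Sub : ub \is a polyOver (SB D).
    by apply/polyOverP => i; rewrite coef_map; apply: bar_span; apply/polyOverP.
  have ubt : ub.[cB t] = bar u.[cA t] by rewrite -bar_c horner_map.
  have Nt : (sg * ub).[cB t] = 0 by rewrite hornerM ubt -sgE -mulrA xy mulr0.
  have SN : sg * ub \is a polyOver (SB D) by rewrite rpredM.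
  have [Q [SQ NE]] : exists Q, Q \is a polyOver (SB D) /\ sg * ub = Q * map_poly cB f0.
    case: f0m => [f00|mf0].
      exists 0; rewrite rpred0 mul0r; split=> //.
      by apply: (vanishing_combination (f := f0)) => //; left.
    have [|||Q [r [SQ Sr NE sr]]] := @polyOver_division _ (SB D) (map_poly cB f0) _ _ (sg * ub).
    - exact: monic_map.
    - apply/polyOverP => i; rewrite coef_map /= -[cB _]mulr1 -(rmorph1 yB) left_span_tens //.
      exact/polyOverP.
    - by [].
    exists Q; split=> //; rewrite NE; suff -> : r = 0 by rewrite addr0.
    apply: (vanishing_combination (f := f0)) => //.
      move: Nt; rewrite NE hornerD hornerM horner_map f0t /= rmorph0 mulr0 add0r //.
    by right; apply: leq_trans sr _; apply: size_poly.
  have [sA SsA sAE] := lift_poly Ssg; have [QA SQA QAE] := lift_poly SQ.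
  have [s' [_ s'E]] := lift_local rhoE vE SsA; have [q [_ qE]] := lift_local rhoE vE SQA.
  have [wR wE] := local_ring_elt eps_pi Sw.
  have rw : rho wR = pi w.
    by rewrite (rhoE wR w 1) ?rmorph1 ?oner_eq0 ?divr1.
  exists (wR%:P * s'), q; split.
    rewrite rmorphM hornerM /= map_polyC hornerC /= rw mulf_neq0 // s'E.
    rewrite map_poly_comp /= sAE /tau /pi /= bar_c horner_map /= -sgE rmorphM mulf_neq0 //.
    exact: pic.
  rewrite !rmorphM /= map_polyC /= rw s'E qE frho mulrAC mul_polyC urho.
  rewrite !map_poly_comp /= sAE QAE -!rmorphM /= mulrC.
  have -> : map_poly bar (map_poly cA f0) = map_poly cB f0.
    by rewrite -map_poly_comp; apply: eq_map_poly => c; apply: bar_c.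
  by rewrite -/ub NE mulrC.
move=> x Sx; have [d [P [Dd d0 SP xE]]] := clear_denominators Sx.
have [X [Xv Xrho]] := lift_local rhoE vE SP.
have [a [s [z [q [s0 z0 sX]]]]] : exists a s z q, [/\ (map_poly rho s).[tau] != 0,
    (map_poly rho z).[tau] != 0 & s * X = a%:P * z + f * q].
  case: fm => [f00|mf].
    exact: (transcendental_step tot reduced_here).
  exact: (algebraic_step tot rho_unit evf reduced_here).
have [ws [us [Sws pws Sus usv usrho]]] := local_denominators rhoE vE s.
have [wz [uz [Swz pwz Suz uzv uzrho]]] := local_denominators rhoE vE z.
have [a' [x1 [y1 [Sx1 Sy1 px1 py1 aE]]]] := local_ring_content goodD a.
have us0 : pi us.[cA t] != 0.
  by rewrite -horner_map /= -usrho hornerZ mulf_neq0.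
have uz0 : pi uz.[cA t] != 0.
  by rewrite -horner_map /= -uzrho hornerZ mulf_neq0.
have E1 : (map_poly v s).[eps (cA t)] * eps P.[cA t] = v a * (map_poly v z).[eps (cA t)].
  rewrite -[eps P.[_]]horner_map /= -Xv -hornerM -rmorphM sX rmorphD !rmorphM /=.
  by rewrite hornerD !hornerM map_polyC hornerC vf mul0r addr0.
have usE : eps us.[cA t] = eps ws * (map_poly v s).[eps (cA t)].
  by rewrite -horner_map /= -usv hornerZ.
have uzE : eps uz.[cA t] = eps wz * (map_poly v z).[eps (cA t)].
  by rewrite -horner_map /= -uzv hornerZ.
exists a', (us.[cA t] * wz * y1 * cA d.[t]), (x1 * uz.[cA t] * ws).
have pd : pi (cA d.[t]) != 0 by rewrite /pi /= bar_c pic.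
have Sd : cA d.[t] \in SA D'.
  by rewrite -[cA _]mulr1 -(rmorph1 vA) left_span_tens // adjoin_poly.
split.
- by rewrite !rpredM // ?polyS // SS.
- by rewrite !rpredM // ?polyS // SS.
- by rewrite !rmorphM !mulf_neq0.
- by rewrite !rmorphM !mulf_neq0.
rewrite -[_ * cA _ * x]mulrA xE !rmorphM usE uzE.
have va : v a = eps (vA a') * (eps x1 / eps y1) by rewrite vE.
transitivity (eps ws * eps wz * eps y1 * (v a * (map_poly v z).[eps (cA t)])).
  by rewrite -E1; ring.
by rewrite va; field; apply: pi0.
Qed.

End Step.

(** Over k, the tensor product is V itself. *)
Lemma content_base : exists D : divringClosed k',
  (forall c, kk' c \in D) /\ has_content eps pi (SA D) vA.
Proof.
pose D0 : {pred k'} := fun x => `[< exists c, x = kk' c >].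
pose D : divringClosed k' := HB.pack D0 (GRing.isDivringClosed.Build k' D0 (image_divring kk')).
exists D; split=> [c|x Sx]; first by apply/asboolP; exists c.
have [a ->] : exists a, x = vA a.
  move: x Sx; apply: left_spanP => [|_ _ [a ->] [b ->]|_ y /asboolP[c ->]].
  - by exists 0; rewrite rmorph0.
  - by exists (a + b); rewrite rmorphD.
  - by exists (kV c * y); have [-> _ _] := hA; rewrite rmorphM.
by exists a, 1, 1; rewrite !rpred1 rmorph1 oner_eq0 mul1r mulr1.
Qed.

Lemma content_tower (ts : seq k') : exists D : divringClosed k',
  [/\ forall c, kk' c \in D, {subset ts <= D} & has_content eps pi (SA D) vA].
Proof.
elim: ts => [|t ts [D [kD tsD goodD]]].
  by have [D [kD goodD]] := content_base; exists D.
pose D' : divringClosed k' := adjoin D t; exists D'; split; last exact: content_adjoin.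
  by move=> c; apply: adjoin_base.
move=> x; rewrite inE => /predU1P[->|/tsD Dx]; first exact: adjoin_gen.
exact: adjoin_base.
Qed.

Lemma content_exists x : exists a s z,
  [/\ pi s != 0, pi z != 0 & eps (s * x) = eps (vA a * z)].
Proof.
have [_ /(_ x)[s xE] _] := hA.
have [D [_ sD goodD]] := content_tower [seq i.1 | i <- s].
have [|a [u [z [_ _ pu pz uE]]]] := goodD x; last by exists a, u, z.
apply/asboolP; exists s => //; apply/allP => i si; apply: sD.
exact: map_f.
Qed.

End Tower.

(** * Separability of the residue extensions *)

Section Separability.
Variables (K L M F1 : fieldType) (a : {rmorphism K -> L}) (b : {rmorphism K -> M}).
Variables (T : comPzRingType) (p : {rmorphism L -> T}) (q : {rmorphism M -> T}).
Hypothesis hT : is_tensor a b p q.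
Variables (u : {rmorphism L -> F1}) (w : {rmorphism M -> F1}) (Phi : {rmorphism T -> F1}).
Hypotheses (Phip : forall x, Phi (p x) = u x) (Phiq : forall y, Phi (q y) = w y).
Hypothesis Phi_local : forall x, Phi x = 0 -> exists s, Phi s != 0 /\ s * x = 0.
Hypothesis Phi_frac : forall z, exists x y, Phi y != 0 /\ z = Phi x / Phi y.

Section BaseChange.
Variables (M' : fieldType) (g : {rmorphism M -> M'}).
Let T1 := tensor a (g \o b).
Let T2 := tensor w g.
Let h1 : is_tensor a (g \o b) (tensl a (g \o b)) (tensr a (g \o b)) := tensor_is_tensor a (g \o b).
Let h2 : is_tensor w g (tensl w g) (tensr w g) := tensor_is_tensor w g.

Variables (Psi : {rmorphism T1 -> T2}) (Theta : {rmorphism T -> T1}).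
Hypotheses (Psil : forall x, Psi (tensl a (g \o b) x) = tensl w g (u x))
  (Psir : forall y, Psi (tensr a (g \o b) y) = tensr w g y).
Hypotheses (Thetal : forall x, Theta (p x) = tensl a (g \o b) x)
  (Thetar : forall y, Theta (q y) = tensr a (g \o b) (g y)).

Lemma base_change_Theta x : Psi (Theta x) = tensl w g (Phi x).
Proof.
have [_ /(_ x)[s ->] _] := hT; rewrite !rmorph_sum /=; apply: eq_bigr => i _.
rewrite !rmorphM Thetal Thetar /= Psil Psir Phip Phiq /=.
by have [-> _ _] := h2.
Qed.

(** Coordinates with respect to M' over M express Z in terms of elements of T, whose images under
    Phi are the coordinates of Psi Z, so they vanish. Each of these elements is then killed by
    some t outside the kernel of Phi, and the product of these t kills Z. *)
Lemma base_change_kernel Z : Psi Z = 0 -> exists t, Phi t != 0 /\ Theta t * Z = 0.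
Proof.
move=> PZ; have [ab1 /(_ Z)[s ZE] univ] := h1; have [ab _ _] := hT.
have [F FE] := finite_coordinates (image_divring g) [seq i.2 | i <- s].
have /choice[h hE] (f : M' * {l : M' -> M' | linear_form (fun x => `[< exists c, x = g c >]) l}) :
    exists h : {additive T1 -> T}, Phi (h Z) = 0 /\
      forall x y, Theta (h (tensl a (g \o b) x * tensr a (g \o b) y)) =
        tensl a (g \o b) x * tensr a (g \o b) (sval f.2 y).
  case: f => n [l [lD lZ lg]]; have /choice[phi phiE] y : exists c, l y = g c by apply/asboolP/lg.
  have phiD y y' : phi (y + y') = phi y + phi y'.
    by apply: (fmorph_inj g); rewrite rmorphD -!phiE lD.
  have phiM c y : phi (g c * y) = c * phi y.
    by apply: (fmorph_inj g); rewrite rmorphM -!phiE lZ //; apply/asboolP; exists c.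
  have [|h hE] := univ T (fun x y => p x * q (phi y)).
    split=> [x x' y|x y y'|c x y]; rewrite ?rmorphD ?mulrDl //.
      by rewrite phiD rmorphD mulrDr.
    by rewrite /= phiM !rmorphM ab mulrA.
  have [_ _ univ2] := h2; have [|h' h'E] := univ2 F1 (fun x y => x * w (phi y)).
    split=> [x x' y|x y y'|c x y]; rewrite ?mulrDl //.
      by rewrite phiD rmorphD mulrDr.
    by rewrite phiM rmorphM mulrA.
  exists h; split; last by move=> x y; rewrite hE rmorphM Thetal Thetar /= phiE.
  have -> : Phi (h Z) = h' (Psi Z); last by rewrite PZ raddf0.
  rewrite ZE !raddf_sum /=; apply: eq_bigr => i _.
  by rewrite hE !rmorphM Phip Phiq Psil Psir h'E.
have /choice[t tE] f := Phi_local (hE f).1.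
exists (\prod_(f <- F) t f); split.
  rewrite rmorph_prod; elim/big_rec: _ => [|f x _]; first exact: oner_neq0.
  by apply: mulf_neq0; case: (tE f).
have -> : Z = \sum_(f <- F) Theta (h f Z) * tensr a (g \o b) f.1.
  transitivity (\sum_(f <- F) \sum_(i <- s)
      tensl a (g \o b) i.1 * tensr a (g \o b) (sval f.2 i.2 * f.1)).
    rewrite exchange_big {1}ZE big_seq [RHS]big_seq; apply: eq_bigr => i si.
    by rewrite -mulr_sumr -rmorph_sum -FE // map_f.
  apply: eq_bigr => f _; have [_ hfE] := hE f.
  rewrite [in RHS]ZE raddf_sum rmorph_sum mulr_suml; apply: eq_bigr => i _.
  by rewrite hfE rmorphM mulrA.
have main G : (forall f, t f * h f Z = 0) ->
    \prod_(f <- G) Theta (t f) * \sum_(f <- G) Theta (h f Z) * tensr a (g \o b) f.1 = 0.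
  move=> th; elim: G => [|f G IH]; first by rewrite !big_nil mulr0.
  rewrite !big_cons; set X := \prod_(_ <- _) _ in IH *; set Y := \sum_(_ <- _) _ in IH *.
  have -> : Theta (t f) * X * (Theta (h f Z) * tensr a (g \o b) f.1 + Y) =
     X * tensr a (g \o b) f.1 * (Theta (t f) * Theta (h f Z)) + Theta (t f) * (X * Y) by ring.
  by rewrite IH -rmorphM th rmorph0 !mulr0 addr0.
by rewrite rmorph_prod main // => f; case: (tE f).
Qed.

Lemma base_change_frac z : exists d Z, Phi d != 0 /\ tensl w g (Phi d) * z = Psi Z.
Proof.
have [_ /(_ z)[s ->] _] := h2; elim: s => [|[x y] s [d [Z [d0 dZ]]]].
  by exists 1, 0; rewrite rmorph1 oner_eq0 big_nil mulr0 rmorph0.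
have [x1 [y1 [y10 xE]]] := Phi_frac x.
exists (d * y1), (Theta d * (Theta x1 * tensr a (g \o b) y) + Theta y1 * Z).
rewrite rmorphM mulf_neq0 //; split=> //.
rewrite big_cons /= mulrDr !rmorphD !rmorphM !base_change_Theta Psir -dZ.
congr (_ + _); last by ring.
by rewrite -(divfK y10 (Phi x1)) -xE rmorphM; ring.
Qed.

(** T2 is the localization of T1 at the elements outside the kernel of Phi. *)
Lemma base_change_reduced : reduced T1 -> reduced T2.
Proof.
move=> red z n zn; have [d [Z [d0 dZ]]] := base_change_frac z.
have [|t [t0 tZ]] := @base_change_kernel (Z ^+ n).
  by rewrite rmorphXn -dZ exprMn zn mulr0.
have {}tZ : Theta t * Z = 0.
  apply: (red _ n.+1); rewrite exprSr exprMn.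
  have -> : Theta t ^+ n * Z ^+ n * (Theta t * Z) = Theta t ^+ n * Z * (Theta t * Z ^+ n) by ring.
  by rewrite tZ mulr0.
have : tensl w g (Phi t * Phi d) * z = 0.
  transitivity (Psi (Theta t * Z)); last by rewrite tZ rmorph0.
  by rewrite !rmorphM /= base_change_Theta -dZ mulrA.
set c := Phi t * Phi d => cz; have c0 : c != 0 by rewrite mulf_neq0.
have e : tensl w g c^-1 * tensl w g c = 1 by rewrite -rmorphM mulVf // rmorph1.
by rewrite -[z]mul1r -e -mulrA cz mulr0.
Qed.

End BaseChange.

(** The hypotheses on Phi say that F1 is the localization of T at a prime. Hence the tensor product
    of F1 and M' over M is a localization of that of L and M' over K, which is reduced. *)
Lemma separable_compositum : separable a -> separable w.
Proof.
move=> sa M' g.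
have h1 := tensor_is_tensor a (g \o b); have h2 := tensor_is_tensor w g.
have [|Psi [Psil Psir]] := is_tensor_rmorph h1
    (u := tensl w g \o u) (v := tensr w g).
  move=> c /=; have [<- _ _] := h2; congr (tensl _ _ _).
  by rewrite -Phip -Phiq; have [-> _ _] := hT.
have [|Theta [Tl Tr]] := is_tensor_rmorph hT
    (u := tensl a (g \o b)) (v := tensr a (g \o b) \o g).
  by move=> c /=; have [-> _ _] := h1.
exact: (base_change_reduced Psil Psir Tl Tr (sa _ _)).
Qed.

End Separability.

(** * The extension and its residue field *)

Definition everything (A : pzRingType) : {pred A} := fun _ => true.
Fact everything_subring (A : pzRingType) : GRing.subring_closed (@everything A).
Proof. by []. Qed.
HB.instance Definition _ (A : pzRingType) := GRing.isSubringClosed.Build A (@everything A)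
  (@everything_subring A).

Lemma value_eq (U : valuationRingType) (x y : mul_group {fraction U}) (c : U) :
  c \is a GRing.unit -> val x = FracField.tofrac c * val y -> value x = value y.
Proof.
move=> uc xE; apply/eqP; rewrite /value -Quotient.idealrBE; apply/asboolP; exists c => //.
by rewrite mul_groupB xE mulfK // (valP y).
Qed.

Lemma value_eqP (U : valuationRingType) (x y : mul_group {fraction U}) :
  value x = value y -> exists2 c : U, c \is a GRing.unit & val x = FracField.tofrac c * val y.
Proof.
move/eqP; rewrite /value -Quotient.idealrBE => /asboolP[c uc xy]; exists c => //.
by rewrite -xy mul_groupB divfK // (valP y).
Qed.

Fact cancel_fraction (K : fieldType) (a b u v : K) : b != 0 -> v != 0 ->
  a * (u * v) / (b * v) = u * (a / b).
Proof. by move=> b0 v0; field; rewrite b0 v0. Qed.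

Section Assembly.
Variables (k : fieldType) (V : valuationRingType) (kV : {rmorphism k -> V}).
Variables (k' : fieldType) (kk' : {rmorphism k -> k'}).
Variables (A B : comNzRingType).
Variables (cA : {rmorphism k' -> A}) (vA : {rmorphism V -> A}).
Variables (cB : {rmorphism k' -> B}) (yB : {rmorphism residue_field V -> B}).
Hypothesis hA : is_tensor kk' kV cA vA.
Hypothesis hB : is_tensor kk' (@residue V \o kV) cB yB.
Variable bar : {rmorphism A -> B}.
Hypotheses (bar_c : forall c, bar (cA c) = cB c) (bar_v : forall v, bar (vA v) = yB (residue v)).
Variables (E kappa : fieldType) (eps : {rmorphism A -> E}) (piB : {rmorphism B -> kappa}).
Hypothesis piB_minimal : forall y, piB y = 0 -> exists s, piB s != 0 /\ s * y = 0.
Let pi : {rmorphism A -> kappa} := piB \o bar.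
Hypothesis eps_neq0 : forall a x, a != 0 -> pi x != 0 -> eps (vA a * x) != 0.

Fact eps_pi0 x : eps x = 0 -> pi x = 0.
Proof.
move=> ex0; apply/eqP; apply: contraT => /(eps_neq0 (oner_neq0 V)).
by rewrite rmorph1 mul1r ex0 eqxx.
Qed.

Definition place_ring := subdomain (local_subring eps_pi0 (@everything A)).
HB.instance Definition _ := GRing.IntegralDomain.on place_ring.
HB.instance Definition _ := SubType.on place_ring.

Fact place_content : has_content eps pi (@everything A) vA.
Proof.
move=> x _; have [a [s [z [ps pz sx]]]] := content_exists hA hB bar_c bar_v piB_minimal eps_pi0 x.
by exists a, s, z.
Qed.

Fact place_ring_valuation (x : {fraction place_ring}) :
  (exists a : place_ring, x = FracField.tofrac a) \/
  (exists a : place_ring, x^-1 = FracField.tofrac a).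
Proof. by apply: fraction_divides => r s; apply: (local_ring_divides place_content). Qed.
HB.instance Definition _ := isValuationRing.Build place_ring place_ring_valuation.

Lemma place_ring_embedding : exists e : {rmorphism A -> place_ring},
  forall x, val (e x) = eps x.
Proof.
apply: subdomain_rmorph => x; apply/asboolP; exists x, 1.
by rewrite !rmorph1 oner_eq0 divr1.
Qed.

Variable e : {rmorphism A -> place_ring}.
Hypothesis eE : forall x, val (e x) = eps x.

Let valM (r s : place_ring) : val (r * s) = val r * val s.
Proof. exact: subdomain_valM. Qed.

Lemma place_ring_frac (r : place_ring) : exists x y, pi y != 0 /\ r * e y = e x.
Proof.
have [x [y [_ _ py rE]]] := local_ringP r; exists x, y; split=> //.
apply: val_inj; rewrite valM !eE rE divfK //.
by apply: contra_neq py; apply: eps_pi0.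
Qed.

Lemma place_unit x : (e x \is a GRing.unit) = (pi x != 0).
Proof.
apply/idP/idP => [ux|px]; last first.
  apply: (@local_ring_unit _ _ _ eps pi eps_pi0 (@everything A) (e x) x 1) => //.
    by rewrite rmorph1 oner_eq0.
  by rewrite rmorph1 divr1 eE.
have [y [z [pz yz]]] := place_ring_frac (e x)^-1.
have : e z = e (x * y).
  by rewrite rmorphM -yz mulrA mulrV // mul1r.
move/(congr1 val); rewrite !eE => /eqP; rewrite -subr_eq0 -rmorphB => /eqP/eps_pi0/eqP.
rewrite rmorphB subr_eq0 => /eqP zE; move: pz; rewrite zE rmorphM.
by apply: contraNneq => ->; rewrite mul0r.
Qed.

Lemma place_ring_content (r : place_ring) : exists a (w : place_ring),
  w \is a GRing.unit /\ r = e (vA a) * w.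
Proof.
have [a [x [y [_ _ px py rE]]]] := local_ring_content place_content r.
exists a, (e x / e y); rewrite unitrM unitrV !place_unit px py; split=> //.
have ey : e y \is a GRing.unit by rewrite place_unit.
apply: (mulIr ey); rewrite mulrA divrK //; apply: val_inj.
rewrite !valM !eE rE mulrA divfK //.
by apply: contra_neq py; apply: eps_pi0.
Qed.

Fact place_injective : injective (e \o vA).
Proof.
move=> a b /eqP; rewrite -subr_eq0 -rmorphB => /eqP ab0; apply/eqP; rewrite -subr_eq0.
apply: contraT => /(@eps_neq0 _ 1); rewrite rmorph1 oner_eq0 mulr1 => /(_ isT).
by rewrite -eE [e _]ab0 [val _]subdomain_val0 eqxx.
Qed.

Fact place_local (a : V) : (e \o vA) a \is a GRing.unit -> a \is a GRing.unit.
Proof.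
rewrite /= place_unit /pi /= bar_v; apply: contraNT => na.
have -> : residue a = 0 by apply/eqP; rewrite residue_eq0.
by rewrite !rmorph0.
Qed.

Definition place_map : V -> place_ring := e \o vA.
HB.instance Definition _ := GRing.RMorphism.copy place_map (e \o vA).
HB.instance Definition _ := isValuationExtension.Build V place_ring place_map
  place_injective place_local.
Let j : valuationExtension V place_ring := place_map.

Let jE a : j a = e (vA a). Proof. by []. Qed.

(** Elements of the extension are scalars of V up to units, whence surjectivity. For injectivity,
    the quotient z of two elements with the same image, or its inverse, lies in V and becomes a
    unit in the extension, so it is a unit of V. *)
Lemma place_weakly_unramified : weakly_unramified j.
Proof.
have inj : injective (value_group_map j).
  move=> x' y'; rewrite -[x']reprK -[y']reprK -/(value _) -/(value (repr y')).
  move: (repr x') (repr y') => x y; rewrite !value_group_mapE => /value_eqP[c uc /= xy].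
  pose z := val x / val y.
  have y0 := valP y; have x0 := valP x.
  have jz : frac_map j z = FracField.tofrac c.
    by rewrite fmorph_div /= xy mulfK // fmorph_eq0.
  have zxy : val x = z * val y by rewrite divfK.
  have [[d zE]|[d zE]] := valring_subproof z.
    apply: (@value_eq _ _ _ d); last by rewrite zxy zE.
    apply: (@valext_local _ _ j); move: jz; rewrite zE frac_map_tofrac => /eqP.
    by rewrite tofrac_eq => /eqP->.
  have ud : d \is a GRing.unit.
    apply: (@valext_local _ _ j); move/(congr1 GRing.inv): jz.
    rewrite -fmorphV zE /= frac_map_tofrac => jd.
    have c0 : c != 0 by apply: contraTneq uc => ->; rewrite unitr0.
    have : FracField.tofrac (j d * c) = 1 by rewrite tofracM jd mulVf // tofrac_eq0.
    rewrite -tofrac1 => /eqP; rewrite tofrac_eq => /eqP jdc.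
    by apply/unitrPr; exists c.
  apply/esym; apply: (value_eq ud).
  by rewrite -zE invf_div divfK.
have surj y : exists x, value_group_map j x = y.
  rewrite -[y]reprK -/(value _); move: (repr y) => {}y.
  have [r [s [s0 yE]]] := fracP (val y).
  have y0 := valP y.
  have [a [u [uu rE]]] := place_ring_content r.
  have [b [v [uv sE]]] := place_ring_content s.
  have r0 : r != 0 by apply: contraNneq y0 => r0; rewrite yE r0 tofrac0 mul0r.
  have a0 : a != 0 by apply: contraNneq r0 => a0; rewrite rE a0 !rmorph0 mul0r.
  have b0 : b != 0 by apply: contraNneq s0 => b0; rewrite sE b0 !rmorph0 mul0r.
  have ab0 : FracField.tofrac a / FracField.tofrac b != 0.
    by rewrite mulf_neq0 ?invr_eq0 ?tofrac_eq0.
  exists (value (Sub (FracField.tofrac a / FracField.tofrac b) ab0)).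
  rewrite value_group_mapE; apply/esym; apply: (@value_eq _ _ _ (u / v)).
    by rewrite unitrM unitrV uu.
  have uvE : FracField.tofrac u = FracField.tofrac (u / v) * FracField.tofrac v.
    by rewrite -tofracM divrK.
  move: (u / v) uvE => c uvE; rewrite yE /= frac_mapE // rE sE !jE !tofracM uvE.
  have v0 : FracField.tofrac v != 0.
    by rewrite tofrac_eq0; apply: contraTneq uv => ->; rewrite unitr0.
  have eb0 : FracField.tofrac (e (vA b)) != 0.
    by rewrite tofrac_eq0 -jE valext_eq0.
  by rewrite (cancel_fraction _ _ eb0 v0).
have /choice[g gE] := surj; exists g => [x|y]; last exact: gE.
by apply: inj; rewrite gE.
Qed.

Let k'W : {rmorphism k' -> place_ring} := e \o cA.

Lemma place_compatible : k'W \o kk' =1 j \o kV.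
Proof. by move=> c; rewrite /= jE; have [-> _ _] := hA. Qed.

Lemma residue_fraction (z : residue_field place_ring) : exists x y,
  pi y != 0 /\ z = residue (e x) / residue (e y).
Proof.
have [r ->] := residueP z; have [x [y [py rE]]] := place_ring_frac r.
exists x, y; split=> //; rewrite -rE rmorphM mulfK // residue_eq0 negbK.
by rewrite place_unit.
Qed.

Lemma place_composite : composite_extension kk' (@residue V \o kV)
  (@residue place_ring \o k'W) (residue_map j).
Proof.
split=> [c|S Sdiv Sk Sv z].
  by rewrite [RHS]residue_mapE /=; have /= -> := place_compatible c.
have [S1 SB Sd] := Sdiv.
have S0 : 0 \in S by rewrite -(subrr 1) SB.
have SD x y : x \in S -> y \in S -> x + y \in S.
  by move=> Sx Sy; rewrite -[y]opprK SB // -sub0r SB.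
have SM x y : x \in S -> y \in S -> x * y \in S.
  by move=> Sx Sy; rewrite -[y]invrK Sd // -div1r Sd.
have Se x : residue (e x) \in S.
  have [_ /(_ x)[s ->] _] := hA; rewrite !rmorph_sum /=.
  elim/big_rec: _ => [|i y _ Sy]; first exact: S0.
  rewrite SD // !rmorphM SM //; first exact: Sk.
  by have /= := Sv (residue i.2); rewrite residue_mapE.
by have [x [y [_ ->]]] := residue_fraction z; rewrite Sd.
Qed.

Lemma place_residue_map : exists Phi : {rmorphism B -> residue_field place_ring},
  (forall c, Phi (cB c) = residue (k'W c)) /\ (forall y, Phi (yB y) = residue_map j y) /\
  (forall x, Phi (bar x) = residue (e x)).
Proof.
have [c|Phi [Phic Phiy]] := is_tensor_rmorph hB
    (u := @residue place_ring \o k'W) (v := residue_map j).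
  exact: place_composite.1.
exists Phi; split=> //; split=> // x.
have [_ /(_ x)[s ->] _] := hA; rewrite !rmorph_sum /=; apply: eq_bigr => i _.
by rewrite !rmorphM bar_c bar_v Phic Phiy /= residue_mapE.
Qed.

Lemma bar_everything y : exists x, y = bar x.
Proof.
have [_ /(_ y)[s ->] _] := hB.
have [|x _ xE] := bar_surj bar_c bar_v (D := @everything k') (y := \sum_(i <- s) cB i.1 * yB i.2).
  by apply/asboolP; exists s => //; apply/allP.
by exists x.
Qed.

Lemma place_residue_separable :
  (separable kk' -> separable (residue_map j)) /\
  (separable (@residue V \o kV) -> separable (@residue place_ring \o k'W)).
Proof.
have [Phi [Phic [Phiy Phib]]] := place_residue_map.
have Phi_pi y : (Phi y != 0) = (piB y != 0).
  have [x ->] := bar_everything y.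
  by rewrite Phib residue_eq0 negbK place_unit.
have Phi_local y : Phi y = 0 -> exists s, Phi s != 0 /\ s * y = 0.
  move/eqP => Py; have [|s [ps sy]] := @piB_minimal y.
    by apply/eqP; move: Py; apply: contraTT; rewrite Phi_pi.
  by exists s; rewrite Phi_pi.
have Phi_frac z : exists x y, Phi y != 0 /\ z = Phi x / Phi y.
  have [x [y [py ->]]] := residue_fraction z.
  by exists (bar x), (bar y); rewrite Phi_pi !Phib.
split.
  exact: (separable_compositum hB (u := @residue place_ring \o k'W) Phic Phiy Phi_local Phi_frac).
exact: (separable_compositum (is_tensorC hB) (w := @residue place_ring \o k'W)
          Phiy Phic Phi_local Phi_frac).
Qed.

Lemma place_extension_exists :
  exists (W : valuationRingType) (j : valuationExtension V W) (k'W : {rmorphism k' -> W}),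
    [/\ weakly_unramified j,
        k'W \o kk' =1 j \o kV,
        composite_extension kk' (@residue V \o kV) (@residue W \o k'W) (residue_map j),
        separable kk' -> separable (residue_map j) &
        separable (@residue V \o kV) -> separable (@residue W \o k'W)].
Proof.
have [sep1 sep2] := place_residue_separable.
exists place_ring, j, k'W; split=> //; first exact: place_weakly_unramified.
  exact: place_compatible.
exact: place_composite.
Qed.

End Assembly.

(** * The theorem *)

(** A linear form that maps 1 to 1 gives a map from the tensor product to B that maps 1 to 1. *)
Lemma tensor_nontrivial (K L : fieldType) (B : comNzRingType)
    (a : {rmorphism K -> L}) (b : {rmorphism K -> B}) : (1 : tensor a b) != 0.
Proof.
have [||l [[lD lZ lK] _ l1]] := linear_form_exists (image_divring a) (U := fun x => x = 0) (x := 1).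
- by split=> // c x y _ -> ->; rewrite mulr0 addr0.
- by apply/eqP; rewrite oner_eq0.
have /choice[phi phiE] x : exists c, l x = a c by apply/asboolP/lK.
have [_ _ univ] := tensor_is_tensor a b.
have [|h hE] := univ B (fun x y => b (phi x) * y).
  split=> [x x' y|x y y'|c x y]; rewrite ?mulrDr //.
    rewrite -mulrDl -rmorphD; congr (b _ * _); apply: (fmorph_inj a).
    by rewrite rmorphD -!phiE lD.
  rewrite mulrA -rmorphM; congr (b _ * _); apply: (fmorph_inj a).
  by rewrite rmorphM -!phiE [x * _]mulrC [RHS]mulrC lZ //; apply/asboolP; exists c.
have p1 : phi 1 = 1 by apply: (fmorph_inj a); rewrite -phiE l1 rmorph1.
have := hE 1 1; rewrite p1 !rmorph1 !mulr1 => h1.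
by apply: contra_eq_neq h1 => ->; rewrite raddf0 eq_sym oner_eq0.
Qed.

Lemma nontrivial_tensor_exists (K L : fieldType) (B : comNzRingType)
    (a : {rmorphism K -> L}) (b : {rmorphism K -> B}) :
  exists (T : comNzRingType) (p : {rmorphism L -> T}) (q : {rmorphism B -> T}),
    is_tensor a b p q /\ (reduced (tensor a b) -> reduced T).
Proof.
pose T : comNzRingType := HB.pack (tensor a b)
  (GRing.PzSemiRing_isNonZero.Build (tensor a b) (tensor_nontrivial a b)).
by exists T, (tensl a b), (tensr a b); split=> //; exact: tensor_is_tensor.
Qed.

(** The coordinates of s with respect to L over K are elements of R killed by c. *)
Lemma scalar_torsion_free (K L : fieldType) (R : idomainType) (a : {rmorphism K -> L})
    (b : {rmorphism K -> R}) (T : comPzRingType) (p : {rmorphism L -> T}) (q : {rmorphism R -> T}) :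
  is_tensor a b p q -> forall c s, c != 0 -> q c * s = 0 -> s = 0.
Proof.
move=> hT c s c0 cs; have hT' := is_tensorC hT.
have [F ->] := right_coordinates hT' s; apply: big1 => -[g [h hh]] _ /=.
suff -> : h s = 0 by rewrite rmorph0 mul0r.
by apply: (mulfI c0); rewrite -(right_formM hT') // cs raddf0 mulr0.
Qed.

Theorem mainTheorem2 (k : fieldType) (V : valuationRingType)
    (kV : {rmorphism k -> V}) (k' : fieldType) (kk' : {rmorphism k -> k'}) :
  reduced (tensor kk' (@residue V \o kV)) ->
  exists (W : valuationRingType) (j : valuationExtension V W)
         (k'W : {rmorphism k' -> W}),
    [/\ weakly_unramified j,
        k'W \o kk' =1 j \o kV,
        composite_extension kk' (@residue V \o kV)
          (@residue W \o k'W) (residue_map j),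
        separable kk' -> separable (residue_map j) &
        separable (@residue V \o kV) -> separable (@residue W \o k'W)].
Proof.
move=> red.
have [A [cA [vA [hA _]]]] := nontrivial_tensor_exists kk' kV.
have [B [cB [yB [hB /(_ red) redB]]]] := nontrivial_tensor_exists kk' (@residue V \o kV).
have [|bar [bar_c bar_v]] := is_tensor_rmorph hA (u := cB) (v := yB \o @residue V).
  by have [] := hB.
have [|||kappa [piB [_ piB_nil]]] := @minimal_prime_field B (fun x => x = 1); first by [].
- by move=> x y -> ->; rewrite mulr1.
- by apply/eqP; rewrite eq_sym oner_eq0.
have piB_minimal y : piB y = 0 -> exists s, piB s != 0 /\ s * y = 0.
  move=> /piB_nil[s [n [ps sy]]]; exists s; split=> //; apply: (redB _ n.+1).
  rewrite exprMn exprSr [y ^+ n.+1]exprS.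
  have -> : s ^+ n * s * (y * y ^+ n) = s ^+ n * y * (s * y ^+ n) by ring.
  by rewrite sy mulr0.
(* The field E: the scalars of V and the elements outside the kernel of pi become nonzero. *)
have [|||E [eps [eps_S _]]] := @minimal_prime_field A
    (fun x => exists a s, [/\ a != 0, piB (bar s) != 0 & x = vA a * s]).
- by exists 1, 1; rewrite !rmorph1 !oner_eq0 mulr1.
- move=> _ _ [a [s [a0 ps ->]]] [b [t [b0 pt ->]]]; exists (a * b), (s * t).
  by rewrite !rmorphM !mulf_neq0 // mulrACA.
- move=> [a [s [a0 ps /esym/(scalar_torsion_free hA a0) s0]]].
  by move: ps; rewrite s0 !rmorph0 eqxx.
have eps_neq0 a x : a != 0 -> piB (bar x) != 0 -> eps (vA a * x) != 0.
  by move=> a0 px; apply: eps_S; exists a, x.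
have [e eE] := place_ring_embedding eps_neq0.
exact: (place_extension_exists hA hB bar_c bar_v piB_minimal eE).
Qed.
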